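(* Let $m\ge2$, let $B\subset\mathbb{R}^m$ be the open unit ball, and let $1\le\nu\le n$ be integers. Let $u\in W^{1,2}(B,\mathbb{S}^n_\nu)$ be a weakly harmonic map. Then $$\operatorname{div}\left(u^i\nabla u^j-u^j\nabla u^i\right)=0\quad\text{in }\mathcal{D}'(B),\qquad\forall\, i,j=1,2,\dots,n+1.$$
   Context: Let $\mathcal{E}=\mathrm{diag}(-I_\nu,I_{n+1-\nu})$. The pseudo-Euclidean space $\mathbb{R}^{n+1}_\nu$ is $\mathbb{R}^{n+1}$ with $\langle v,w\rangle_{\mathbb{R}^{n+1}_\nu}=v^T\mathcal{E}w$. The pseudosphere is $\mathbb{S}^n_\nu=\{y\in\mathbb{R}^{n+1}_\nu: y^T\mathcal{E}y=1\}$ with the induced metric, and $$W^{1,2}(B,\mathbb{S}^n_\nu)=\{u=(u^1,\dots,u^{n+1})^T\in W^{1,2}(B,\mathbb{R}^{n+1}): u^T\mathcal{E}u=1\text{ a.e. in }B\}.$$ For $u\in W^{1,2}(B,\mathbb{S}^n_\nu)$ let $$E(u)=\frac12\int_B(\nabla u)^T\mathcal{E}\,\nabla u=-\frac12\int_B\big(|\nabla u^1|^2+\dots+|\nabla u^\nu|^2\big)+\frac12\int_B\big(|\nabla u^{\nu+1}|^2+\dots+|\nabla u^{n+1}|^2\big).$$ $u$ is called weakly harmonic if it is a critical point of $E$ in $W^{1,2}(B,\mathbb{S}^n_\nu)$, i.e. $\frac{d}{dt}\big|_{t=0}E(u_t)=0$ for every family $u_t\in W^{1,2}(B,\mathbb{S}^n_\nu)$,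 $t$ near $0$, with $u_0=u$, $u_t=u$ outside a fixed compact subset of $B$, and $t\mapsto u_t$ differentiable at $0$ in $W^{1,2}$. *)

(* Defs.v *)
From HB Require Import structures.
From mathcomp Require Export all_boot all_order all_algebra.
From mathcomp Require Export all_classical all_reals all_analysis.

Set Implicit Arguments.
Unset Strict Implicit.
Unset Printing Implicit Defensive.
Import Order.TTheory GRing.Theory Num.Theory.
Import numFieldNormedType.Exports.

Local Open Scope classical_set_scope.
Local Open Scope ring_scope.

(* Matrices carry the sigma-algebra generated by the coordinate functions; over
   R this is the Borel sigma-algebra. *)
Definition measure_mx_display : measure_display -> measure_display.
Proof. exact. Qed.

Section measurable_mx.
Context {d} {T : measurableType d} (m n : nat).

Definition mx_cylinders : set (set 'M[T]_(m, n)) :=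
  [set A | exists i j, exists2 Y, measurable Y & A = (fun M : 'M[T]_(m, n) => M i j) @^-1` Y].

Let mx_set0 : <<s mx_cylinders >> set0.
Proof. exact: sigma_algebra0. Qed.

Let mx_setC A : <<s mx_cylinders >> A -> <<s mx_cylinders >> (~` A).
Proof. exact: sigma_algebraC. Qed.

Let mx_bigcup (F : (set 'M[T]_(m, n))^nat) :
  (forall i, <<s mx_cylinders >> (F i)) -> <<s mx_cylinders >> (\bigcup_i (F i)).
Proof. exact: sigma_algebra_bigcup. Qed.

HB.instance Definition _ := @isMeasurable.Build (measure_mx_display d)
  'M[T]_(m, n) <<s mx_cylinders >> mx_set0 mx_setC mx_bigcup.

End measurable_mx.

Lemma measurable_coord d (T : measurableType d) m n (i : 'I_m) (j : 'I_n) :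
  measurable_fun [set: 'M[T]_(m, n)] (fun M : 'M[T]_(m, n) => M i j).
Proof.
move=> _ Y mY; rewrite setTI; apply: sub_sigma_algebra.
by exists i, j, Y.
Qed.

Lemma measurable_fun_mx d d' (S : measurableType d') (T : measurableType d)
    m n (f : S -> 'M[T]_(m, n)) :
  (forall i j, measurable_fun setT (fun x => f x i j)) -> measurable_fun setT f.
Proof.
move=> mf; apply: (measurability (@mx_cylinders _ T m n)) => //.
by move=> _ [_ [i [j [Y mY ->]]] <-]; exact: mf.
Qed.

Section lebesgue_rV.
Context {R : realType}.

Definition consmx m (p : R * 'rV[R]_m) : 'rV[R]_m.+1 :=
  \row_j oapp (p.2 ord0) p.1 (unlift ord0 j).

Definition unconsmx m (x : 'rV[R]_m.+1) : R * 'rV[R]_m :=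
  (x ord0 ord0, \row_j x ord0 (lift ord0 j)).

Lemma consmxK m : cancel (@consmx m) (@unconsmx m).
Proof.
move=> [a x]; rewrite /unconsmx /consmx mxE unlift_none /=; congr pair.
by apply/rowP => j; rewrite !mxE liftK.
Qed.

Lemma measurable_consmx m : measurable_fun setT (@consmx m).
Proof.
apply: measurable_fun_mx => i j.
under eq_fun do rewrite mxE.
case: unliftP => [k _|_] /=; last exact: measurable_fst.
exact: (measurableT_comp
  (@measurable_coord _ (measurableTypeR R) 1 m ord0 k) measurable_snd).
Qed.

Lemma measurable_unconsmx m : measurable_fun setT (@unconsmx m).
Proof.
apply: measurable_fun_pair => /=; first exact: measurable_coord.
apply: measurable_fun_mx => i j.
under eq_fun do rewrite mxE.
exact: measurable_coord.
Qed.

Section step.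
Context m (mu : {sigma_finite_measure set 'rV[R]_m -> \bar R}).

Definition lebesgue_step : set 'rV[R]_m.+1 -> \bar R :=
  pushforward (@lebesgue_measure R \x mu)%E (@consmx m).

#[local] Hint Extern 0 (measurable_fun _ _) =>
  solve [exact: measurable_consmx] : core.

Let lebesgue_step0 : lebesgue_step set0 = 0%E.
Proof. exact: measure0. Qed.

Let lebesgue_step_ge0 A : (0 <= lebesgue_step A)%E.
Proof. exact: measure_ge0. Qed.

Let lebesgue_step_sigma_additive : semi_sigma_additive lebesgue_step.
Proof.
exact: measure_semi_sigma_additive.
Qed.

HB.instance Definition _ := isMeasure.Build _ _ _ lebesgue_step
  lebesgue_step0 lebesgue_step_ge0 lebesgue_step_sigma_additive.

Let lebesgue_step_sigma_finite : sigma_finite setT lebesgue_step.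
Proof.
have /sigma_finiteP[F [TF ndF Foo]] := sigma_finiteT (@lebesgue_measure R).
have /sigma_finiteP[G [TG ndG Goo]] := sigma_finiteT mu.
exists (fun k => @unconsmx m @^-1` (F k `*` G k)).
  apply/seteqP; split => // x _; case xay : (unconsmx x) => [a y].
  have [k _ Fka] : (\bigcup_k F k) a by rewrite -TF.
  have [l _ Gly] : (\bigcup_k G k) y by rewrite -TG.
  exists (maxn k l) => //; rewrite /preimage/mkset xay; split => /=.
  - by move: a Fka {xay}; exact/subsetPset/ndF/leq_maxl.
  - by move: y Gly {xay}; exact/subsetPset/ndG/leq_maxr.
move=> k; have [mF Fk] := Foo k; have [mG Gk] := Goo k; split.
  rewrite -[X in measurable X]setTI; apply: measurable_unconsmx => //.
  exact: measurableX.
rewrite /lebesgue_step /pushforward -comp_preimage.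
rewrite (_ : _ \o _ = id); last by apply/funext => p; exact: consmxK.
by rewrite preimage_id product_measure1E// lte_mul_pinfty// ge0_fin_numE.
Qed.

HB.instance Definition _ := Measure_isSigmaFinite.Build _ _ _ lebesgue_step
  lebesgue_step_sigma_finite.

End step.

Fixpoint lebesgue_rV m : {sigma_finite_measure set 'rV[R]_m -> \bar R} :=
  if m is k.+1 then lebesgue_step (lebesgue_rV k) else \d_(0 : 'rV[R]_0).

Lemma lebesgue_rV_box m (A : 'I_m -> set R) : (forall k, measurable (A k)) ->
  lebesgue_rV m [set x | forall k, A k (x ord0 k)] =
    (\prod_(k < m) lebesgue_measure (A k))%E.
Proof.
elim: m A => [|m IHm] A mA /=.
  by rewrite big_ord0 diracE mem_set//= => -[].
rewrite big_ord_recl -(IHm (fun k => A (lift ord0 k)))//.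
rewrite /lebesgue_step /pushforward -product_measure1E//; last first.
  set S := (X in measurable X).
  have -> : S = \bigcap_(k in [set: 'I_m])
      ((fun x : 'rV[R]_m => x ord0 k) @^-1` A (lift ord0 k)).
    by apply/seteqP; split => x /= h k; [move=> _; exact: h|exact: h].
  apply: fin_bigcap_measurable => // k _.
  by rewrite -[X in measurable X]setTI; exact: (measurable_coord _ _).
  exact: mA.
congr (product_measure1 _ _ _).
apply/seteqP; split => -[a x] /=; rewrite /consmx.
  move=> h; split => [|k].
    by have := h ord0; rewrite mxE unlift_none.
  by have := h (lift ord0 k); rewrite mxE liftK.
move=> [Aa Ax] k; rewrite mxE; case: unliftP => [j ->|->] //=; exact: Ax.
Qed.

End lebesgue_rV.

Section sobolev.
Context {R : realType} (m : nat).
Local Notation "'mu'" := (lebesgue_rV m : {measure set 'rV[R]_m -> \bar R}).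

(* The norm of 'rV[R]_m is the sup norm, hence the explicit Euclidean ball. *)
Definition B1 : set 'rV[R]_m := [set x | \sum_k x ord0 k ^+ 2 < 1].

Definition partial (k : 'I_m) (f : 'rV[R]_m -> R) : 'rV[R]_m -> R :=
  fun x => 'D_(delta_mx ord0 k) f x.

Fixpoint Ck (r : nat) (f : 'rV[R]_m -> R) : Prop :=
  if r is r'.+1 then
    [/\ continuous f,
        forall k x, derivable f x (delta_mx ord0 k)
      & forall k, Ck r' (partial k f)]
  else continuous f.

Definition smooth (f : 'rV[R]_m -> R) : Prop := forall r, Ck r f.

Definition supp (f : 'rV[R]_m -> R) : set 'rV[R]_m := closure [set x | f x != 0].

Definition test_function (phi : 'rV[R]_m -> R) : Prop :=
  [/\ smooth phi, compact (supp phi) & supp phi `<=` B1].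

Definition L2 (f : 'rV[R]_m -> R) : Prop :=
  measurable_fun B1 f /\ mu.-integrable B1 (fun x => (f x ^+ 2)%:E).

Definition weak_partial (k : 'I_m) (f g : 'rV[R]_m -> R) : Prop :=
  forall phi, test_function phi ->
    \int[mu]_(x in B1) (f x * partial k phi x) =
    - \int[mu]_(x in B1) (g x * phi x).

Definition W12 (f : 'rV[R]_m -> R) : Prop :=
  L2 f /\ forall k, exists2 g, L2 g & weak_partial k f g.

(* A representative of the weak derivative, which is unique up to a null set. *)
Definition wpartial (k : 'I_m) (f : 'rV[R]_m -> R) : 'rV[R]_m -> R :=
  xget (fun=> 0) [set g | L2 g /\ weak_partial k f g].

Definition wgrad (f : 'rV[R]_m -> R) (x : 'rV[R]_m) : 'rV[R]_m :=
  \row_k wpartial k f x.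

Definition locally_L1 (f : 'rV[R]_m -> R) : Prop :=
  forall K, compact K -> K `<=` B1 -> mu.-integrable K (EFin \o f).

Definition distr_div (F : 'rV[R]_m -> 'rV[R]_m) (phi : 'rV[R]_m -> R) : R :=
  - \int[mu]_(x in B1) \sum_k F x ord0 k * partial k phi x.

(* Local integrability makes F a distribution, so that the integrals defining
   its divergence are not default values. *)
Definition div_free (F : 'rV[R]_m -> 'rV[R]_m) : Prop :=
  (forall k, locally_L1 (fun x => F x ord0 k)) /\
  forall phi, test_function phi -> distr_div F phi = 0.

Section vector_valued.
Context (N : nat).
Implicit Types u v : 'rV[R]_m -> 'cV[R]_N.

Definition component u (i : 'I_N) : 'rV[R]_m -> R := fun x => u x i ord0.

Definition vW12 u : Prop := forall i, W12 (component u i).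

Definition jac u (x : 'rV[R]_m) : 'M[R]_(N, m) :=
  \matrix_(i, k) wgrad (component u i) x ord0 k.

Definition vW12_norm u : R :=
  Num.sqrt (\sum_i (\int[mu]_(x in B1) (u x i ord0 ^+ 2) +
                    \sum_k \int[mu]_(x in B1) (jac u x i k ^+ 2))).

Definition W12_differentiable0 (U : R -> 'rV[R]_m -> 'cV[R]_N) : Prop :=
  exists2 v, vW12 v &
    (fun t => vW12_norm (fun x => t^-1 *: (U t x - U 0 x) - v x)) @ 0^' --> 0.

End vector_valued.

End sobolev.
Arguments B1 {R} m.

Section pseudosphere.
Context {R : realType} (m n nu : nat).
Local Notation "'mu'" := (lebesgue_rV m : {measure set 'rV[R]_m -> \bar R}).

Definition Emx : 'M[R]_n.+1 :=
  diag_mx (\row_i (if (i < nu)%N then -1 else 1)).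

Definition psphere : set 'cV[R]_n.+1 := [set y | y^T *m Emx *m y = 1%:M].

Definition W12_psphere (u : 'rV[R]_m -> 'cV[R]_n.+1) : Prop :=
  vW12 u /\ {ae mu, forall x, B1 m x -> psphere (u x)}.

(* (\nabla u)^T E \nabla u as a scalar: the trace of the m x m matrix. *)
Definition energy (u : 'rV[R]_m -> 'cV[R]_n.+1) : R :=
  2^-1 * \int[mu]_(x in B1 m) \tr ((jac u x)^T *m Emx *m jac u x).

Definition admissible (u : 'rV[R]_m -> 'cV[R]_n.+1)
    (U : R -> 'rV[R]_m -> 'cV[R]_n.+1) : Prop :=
  [/\ \forall t \near 0, W12_psphere (U t),
      {ae mu, forall x, B1 m x -> U 0 x = u x},
      (exists K, [/\ compact K, K `<=` B1 m & \forall t \near 0,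
         {ae mu, forall x, B1 m x -> ~ K x -> U t x = u x}])
    & W12_differentiable0 U].

Definition weakly_harmonic (u : 'rV[R]_m -> 'cV[R]_n.+1) : Prop :=
  W12_psphere u /\
  forall U, admissible u U -> is_derive (0 : R) 1 (energy \o U) 0.

End pseudosphere.

(* Main.v *)
Require Import Defs.
From mathcomp Require Import measurable_realfun ring lra.
Import Order.TTheory GRing.Theory Num.Theory.
Import numFieldNormedType.Exports.

(** This is Noether's theorem for the linear isometries of the pseudosphere.
    The group preserving the form y^T E y contains, for every pair i <> j of
    coordinates, a one-parameter group moving only these two: ordinary rotations
    when the signs eps_i, eps_j agree, hyperbolic rotations otherwise.  Its
    generator X has (X y)_i = eps_i y_j and (X y)_j = - eps_j y_i.  For a test
    function phi, rotate u(x) by the angle t phi(x).  The resulting map stays on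
    the pseudosphere, equals u off the support of phi, and its gradient is, up
    to the same rotation, grad u + t (grad phi) X u ([pseudorotation_gradient]).
    Rotations preserve the form, so the energy is exactly quadratic in t, and
    its linear coefficient is the distributional divergence of the current
    u^i grad u^j - u^j grad u^i tested against phi ([energy_variation]).
    Criticality makes this coefficient vanish; for i = j the current is zero.

    The rest makes this computation legitimate.  The energy and the Sobolev norm
    are expressed with chosen representatives of the weak derivatives, so these
    must be unique almost everywhere ([weak_partial_unique]).  Uniqueness is the
    fundamental lemma of the calculus of variations ([fundamental_lemma]): a
    square-integrable g orthogonal to all test functions is null.  For smooth
    h >= 0, the test functions 1 - exp (- N chi_N h), where chi_N is a bump
    exhausting the ball, converge on the ball to the indicator of the set
    h > 0, hence g has integral 0 over each such set.  These sets are stable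
    under intersection (multiply the functions h) and generate the Borel sets,
    so Dynkin's theorem gives integral 0 over every Borel set.

    Weak gradients obey the product rule with smooth factors
    ([weak_gradientM]), which gives the weak gradient of the variation, and
    second-order estimates of cos, sin, cosh, sinh at 0 show that the variation
    is differentiable in the Sobolev norm ([variation_differentiable]). *)

Set Implicit Arguments.
Unset Strict Implicit.
Unset Printing Implicit Defensive.

Local Open Scope classical_set_scope.
Local Open Scope ring_scope.

(** * Functions with continuous iterated partial derivatives *)

Section differentiability_classes.
Context {R : realType} (m : nat).
Implicit Types (f g h : 'rV[R]_m -> R) (r : nat) (k : 'I_m).

Lemma CkS r f : Ck r.+1 f -> Ck r f.
Proof.
elim: r f => [|r IHr] f [cf df pf]; first exact: cf.
by split=> // k; exact/IHr/pf.
Qed.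

Lemma Ck_continuous r f : Ck r f -> continuous f.
Proof. by case: r => // r []. Qed.

Lemma partial_cst k (c : R) : partial k (fun _ : 'rV[R]_m => c) = (fun=> 0).
Proof. by apply/funext => x; exact: derive_cst. Qed.

Lemma Ck_cst r (c : R) : Ck r (fun _ : 'rV[R]_m => c).
Proof.
elim: r c => [|r IHr] c; first exact: cst_continuous.
split=> [|k x|k]; [exact: cst_continuous|exact: derivable_cst|].
rewrite partial_cst; exact: IHr.
Qed.

Lemma derivable_coord k i x :
  derivable (fun y : 'rV[R]_m => y ord0 i : R) x (delta_mx ord0 k).
Proof. exact/diff_derivable/differentiable_coord. Qed.

Lemma partial_coord k i :
  partial k (fun y : 'rV[R]_m => y ord0 i) = (fun=> (i == k)%:R).
Proof.
apply/funext => x; rewrite /partial /derive; apply/lim_near_cst => //.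
near=> h; have h0 : h != 0 by near: h; exact: nbhs_dnbhs_neq.
by rewrite /= !mxE eqxx /= addrK scalerA mulVf// scale1r.
Unshelve. all: by end_near. Qed.

Lemma Ck_coord r i : Ck r (fun y : 'rV[R]_m => y ord0 i).
Proof.
case: r => [|r]; first exact: coord_continuous.
split=> [|k x|k]; [exact: coord_continuous|exact: derivable_coord|].
by rewrite partial_coord; exact: Ck_cst.
Qed.

Lemma CkD r f g : Ck r f -> Ck r g -> Ck r (fun x => f x + g x).
Proof.
elim: r f g => [|r IHr] f g.
  by move=> /= cf cg x; exact: (continuousD (cf x) (cg x)).
move=> [cf df pf] [cg dg pg]; split=> [x|k x|k].
- exact: (continuousD (cf x) (cg x)).
- by apply: derivableD; [exact: df|exact: dg].
- suff -> : partial k (fun x => f x + g x) =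
      (fun x => partial k f x + partial k g x).
    by apply: IHr; [exact: pf|exact: pg].
  by apply/funext => x; exact: deriveD.
Qed.

Lemma partialM k f g x : derivable f x (delta_mx ord0 k) ->
  derivable g x (delta_mx ord0 k) ->
  partial k (fun y => f y * g y) x = partial k f x * g x + f x * partial k g x.
Proof. by move=> df dg; rewrite /partial deriveM// addrC /GRing.scale/= mulrC. Qed.

Lemma partialZ k (c : R) f x : derivable f x (delta_mx ord0 k) ->
  partial k (fun y => c * f y) x = c * partial k f x.
Proof. by move=> df; exact: (deriveZ c df). Qed.

Lemma CkM r f g : Ck r f -> Ck r g -> Ck r (fun x => f x * g x).
Proof.
elim: r f g => [|r IHr] f g.
  by move=> /= cf cg x; exact: (continuousM (cf x) (cg x)).
move=> Cf Cg; have [cf df pf] := Cf; have [cg dg pg] := Cg; split=> [x|k x|k].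
- exact: (continuousM (cf x) (cg x)).
- by apply: derivableM; [exact: df|exact: dg].
- suff -> : partial k (fun x => f x * g x) =
      (fun x => partial k f x * g x + f x * partial k g x).
    apply: CkD; apply: IHr; [exact: pf|exact: CkS Cg|exact: CkS Cf|exact: pg].
  by apply/funext => x; exact: partialM.
Qed.

Lemma derive_line f x v : 'D_1 (fun s : R => f (s *: v + x)) 0 = 'D_v f x.
Proof.
rewrite /derive; congr (lim (_ @ 0^')); apply/funext => s /=.
by rewrite addr0 scale0r add0r [_%:A]mulr1.
Qed.

(** Only directional derivability of the inner function is available, since
    smoothness is defined by iterated partial derivatives; restricting to a line
    makes the one-variable chain rule applicable. *)
Lemma is_derive_comp_dir (F : R -> R) (dF : R) h x v :
  is_derive (h x) 1 F dF -> derivable h x v ->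
  is_derive x v (F \o h) (dF * 'D_v h x).
Proof.
move=> dFx dh; have dh1 := (derivable1P _ _ _).1 dh.
have h0 : h (0 *: v + x) = h x by rewrite scale0r add0r.
have H : is_derive (0 : R) 1 (F \o (fun s : R => h (s *: v + x)))
    (dF * 'D_v h x).
  rewrite -derive_line; apply: is_derive1_comp; last exact/derivableP.
  by rewrite h0.
split; first by apply/derivable1P; by case: H.
rewrite -derive_line; by case: H.
Qed.

(** Coinductive smoothness of one-variable functions: membership in such a class
    provides derivatives of all orders without naming them, which is all that
    the chain rule consumes. *)
Definition derivative_closed (S : set (R -> R)) :=
  forall F, S F -> exists2 dF, S dF & forall x : R, is_derive x 1 F (dF x).

Lemma derivative_closed_continuous S F :
  derivative_closed S -> S F -> continuous F.
Proof.
move=> dS /dS[dF _ FdF] x; apply/differentiable_continuous.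
by apply/derivable1_diffP; by case: (FdF x).
Qed.

(** The partial derivatives of F o h are F' o h times those of h, and F' is again
    in the class S, so induction on the order applies with F generalized. *)
Lemma Ck_comp S F r h : derivative_closed S -> S F -> Ck r h -> Ck r (F \o h).
Proof.
move=> dS; elim: r F h => [|r IHr] F h SF Ch.
  move=> x; apply: continuous_comp; first exact: (Ck_continuous Ch).
  exact: derivative_closed_continuous SF (h x).
have [dF SdF FdF] := dS _ SF; have [ch dh ph] := Ch; split=> [x|k x|k].
- apply: continuous_comp; first exact: ch.
  exact: derivative_closed_continuous SF (h x).
- by case: (is_derive_comp_dir (FdF (h x)) (dh k x)).
- suff -> : partial k (F \o h) = (fun x => (dF \o h) x * partial k h x).
    by apply: CkM; [apply: IHr => //; exact: CkS Ch|exact: ph].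
  apply/funext => x.
  by case: (is_derive_comp_dir (FdF (h x)) (dh k x)).
Qed.

Lemma Ck_sum (I : Type) (s : seq I) r (F : I -> 'rV[R]_m -> R) :
  (forall i, Ck r (F i)) -> Ck r (fun x => \sum_(i <- s) F i x).
Proof.
move=> CF; elim: s => [|i s IHs].
  by under eq_fun do rewrite big_nil; exact: Ck_cst.
by under eq_fun do rewrite big_cons; exact: CkD.
Qed.

Lemma CkZ r (c : R) f : Ck r f -> Ck r (fun x => c * f x).
Proof. by move=> Cf; apply: CkM => //; exact: Ck_cst. Qed.

End differentiability_classes.

(** * Flat functions *)

Section flat_functions.
Context {R : realType}.
Implicit Types (P : {poly R}) (x y : R).

(** The functions P(1/x) exp(-1/x) extended by 0 to x <= 0; with the polynomial
    factor they form a class closed under derivation. *)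
Definition flat P x : R :=
  if 0 < x then P.[x^-1] * expR (- x^-1) else 0.

Lemma flat_le0 P x : x <= 0 -> flat P x = 0.
Proof. by move=> x0; rewrite /flat ltNge x0. Qed.

Lemma flat1_gt0 x : 0 < x -> 0 < flat 1 x.
Proof. by move=> x0; rewrite /flat x0 hornerC mul1r expR_gt0. Qed.

Lemma flat1_ge0 x : 0 <= flat 1 x.
Proof. by have [/flat_le0->|/flat1_gt0/ltW] := leP x 0. Qed.

(** The spare factor y^2 is what makes the difference quotient at 0 tend to 0. *)
Lemma horner_le_expR P :
  exists2 c, 0 < c & forall y, 1 <= y -> `|P.[y]| * y ^+ 2 <= c * expR y.
Proof.
pose d := size P.
pose K := 1 + \sum_(i < d) `|P`_i|.
have K0 : 0 < K by rewrite ltr_pwDl ?sumr_ge0.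
exists (K * (d.+2)`!%:R); first by rewrite mulr_gt0// ltr0n fact_gt0.
move=> y y1; have y0 : 0 <= y by rewrite (le_trans ler01).
have Py : `|P.[y]| <= K * y ^+ d.
  rewrite horner_coef (le_trans (ler_norm_sum _ _ _))// mulrDl mul1r mulr_suml.
  rewrite ler_wpDl ?exprn_ge0//.
  apply: ler_sum => i _; rewrite normrM ler_wpM2l// ger0_norm ?exprn_ge0//.
  by rewrite ler_weXn2l// ltnW.
apply: (@le_trans _ _ (K * y ^+ d * y ^+ 2)).
  by rewrite ler_wpM2r// exprn_ge0.
rewrite -!mulrA ler_wpM2l ?(ltW K0)// -exprD addn2.
have := @expR_ge1Dxn R y d.+1 y0.
rewrite -ler_pdivrMl ?ltr0n ?fact_gt0// mulrC; apply: le_trans.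
by rewrite ler_wpDl.
Qed.

Lemma flat_quotient_cvg0 P : h^-1 * flat P h @[h --> (0:R)^'] --> (0 : R).
Proof.
have [c c0 Pc] := horner_le_expR P.
apply/cvgr0Pnorm_le => e e0 /=.
near=> h; have hn0 : h != 0 by near: h; exact: nbhs_dnbhs_neq.
have [h0|h0] := leP h 0; first by rewrite flat_le0// mulr0 normr0 ltW.
have h1 : h <= 1.
  apply: le_trans (ler_norm h) _; near: h.
  by apply: dnbhs0_le.
have hi1 : 1 <= h^-1 by rewrite invf_ge1.
rewrite /flat h0 !normrM (ger0_norm (expR_ge0 _)) expRN.
have -> : `|h^-1| = h * h^-1 ^+ 2.
  by rewrite gtr0_norm ?invr_gt0// expr2 mulrA mulfV ?mul1r.
rewrite -!mulrA; apply: (@le_trans _ _ (h * c)).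
  rewrite ler_pM2l// !mulrA ler_pdivrMr ?expR_gt0// mulrC; exact: Pc.
rewrite -ler_pdivlMr//.
apply: le_trans (ler_norm h) _; near: h; apply: dnbhs0_le.
by rewrite divr_gt0.
Unshelve. all: by end_near. Qed.

(** With y = 1/x, one has y' = - y^2, whence the polynomial X^2 (P - P'). *)
Lemma is_derive_flat P x :
  is_derive x 1 (flat P) (flat ('X^2 * (P - P^`())) x).
Proof.
have [x0|x0|->] := ltgtP x 0.
- rewrite [X in is_derive _ _ _ X]flat_le0 ?ltW//.
  apply: (@near_eq_is_derive _ _ _ (cst 0)).
  near=> y; rewrite flat_le0// ltW//; near: y; exact: lt_nbhsl.
- apply: (@near_eq_is_derive _ _ _
      (fun y : R => P.[y^-1] * expR (- y^-1))).
    near=> y; rewrite /flat ifT//; near: y; exact: lt_nbhsr.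
  have xn0 : x != 0 by rewrite gt_eqF.
  have dV : is_derive x 1 (fun y : R => y^-1) (- x ^- 2).
    have := @is_deriveV R id x 1 1 xn0 (is_derive_id _ _).
    by rewrite /GRing.scale/= mulr1.
  have dP := @is_derive1_comp R (horner P) _ x _ _ (is_derive_poly _ _) dV.
  have dE := @is_derive1_comp R (@expR R) _ x _ _ (is_derive_expR _)
    (@is_deriveN _ _ _ _ _ _ _ dV).
  have := @is_deriveM _ _ _ _ _ _ _ _ dP dE.
  move=> H; refine (is_derive_eq H _).
  have -> : flat ('X^2 * (P - P^`())) x =
      x^-1 ^+ 2 * (P.[x^-1] - P^`().[x^-1]) * expR (- x^-1).
    by rewrite /flat x0 !hornerE.
  rewrite /GRing.scale/= -exprVn -[(- (fun y : R => y^-1)) x]/(- x^-1).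
  by ring.
- rewrite [X in is_derive _ _ _ X]flat_le0//.
  have H := @flat_quotient_cvg0 P.
  have E : (fun h : R => h^-1 *: ((flat P \o shift 0) (h *: 1) - flat P 0)) =
    (fun h => h^-1 * flat P h).
    apply/funext => h /=; rewrite addr0 (flat_le0 _ (lexx 0)) subr0.
    by rewrite [_ *: 1]mulr1.
  split; rewrite /derivable /derive E; first by apply/cvg_ex; exists 0.
  exact/cvg_lim.
Unshelve. all: by end_near. Qed.
End flat_functions.

(** * Borel sets of row vectors and square integrability on the ball *)

Section borel.
Context {R : realType} (m : nat).

(** An open set is the union of the boxes with rational centre and radius that it
    contains, and there are countably many of these. *)
Lemma open_measurable_rV (O : set 'rV[R]_m) : open O -> measurable O.
Proof.
move=> oO.
pose box (q : 'rV[rat]_m * rat) : set 'rV[R]_m :=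
  [set x | forall k, `|x ord0 k - ratr (q.1 ord0 k)| < ratr q.2].
have mbox q : measurable (box q).
  have -> : box q = \bigcap_(k in [set: 'I_m])
      ((fun x : 'rV[R]_m => x ord0 k) @^-1`
        [set y | `|y - ratr (q.1 ord0 k)| < ratr q.2]).
    by apply/seteqP; split => x h k //=; exact: h.
  apply: fin_bigcap_measurable => // k _.
  rewrite -[X in measurable X]setTI; apply: measurable_coord => //.
  rewrite (_ : [set _ | _] =
      `]ratr (q.1 ord0 k) - ratr q.2, ratr (q.1 ord0 k) + ratr q.2[%classic)//.
  by apply/seteqP; split => y /=; rewrite in_itv/= ltr_distl.
have -> : O = \bigcup_q (if `[< box q `<=` O >] then box q else set0).
  apply/seteqP; split => [x Ox|x [q _]]; last by case: asboolP => // qO /qO.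
  have /nbhs_ballP[e /= e0 eO] : nbhs x O by exact: open_nbhs_nbhs.
  have [r] : exists r : rat, ratr r \in `]0, e / 2[.
    by apply: rat_in_itvoo; rewrite divr_gt0.
  rewrite in_itv/= => /andP[r0 re].
  have /choice[q qx] : forall k, exists q : rat, `|x ord0 k - ratr q| < ratr r.
    move=> k; have [q] : exists q : rat,
        ratr q \in `]x ord0 k - ratr r, x ord0 k + ratr r[.
      by apply: rat_in_itvoo; rewrite ltrD2l gtrN.
    rewrite in_itv/= => /andP[q1 q2]; exists q.
    by rewrite distrC ltr_distl q1.
  exists (\row_k q k, r) => //; case: asboolP => [_ k|]; first by rewrite mxE.
  case=> y yq; apply: eO; split => // i k; rewrite ord1.
  have := yq k; have := qx k; rewrite /= mxE => h1 h2.
  rewrite /ball/= -(subrK (ratr (q k)) (x ord0 k)) -addrA.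
  rewrite (le_lt_trans (ler_normD _ _))// (splitr e) ltrD//.
    exact: lt_trans re.
  by rewrite distrC; exact: lt_trans re.
apply: countable_bigcupT_measurable; first exact: countableP.
by move=> q; case: asboolP.
Qed.

Lemma closed_measurable_rV (F : set 'rV[R]_m) : closed F -> measurable F.
Proof.
move=> cF; rewrite -[F]setCK; apply: measurableC.
by apply: open_measurable_rV; exact: closed_openC.
Qed.

Lemma compact_measurable_rV (K : set 'rV[R]_m) : compact K -> measurable K.
Proof.
by move=> cK; apply: closed_measurable_rV; apply: compact_closed => //;
  exact: norm_hausdorff.
Qed.

Lemma continuous_measurable_rV (f : 'rV[R]_m -> R) (D : set 'rV[R]_m) :
  continuous f -> measurable_fun D f.
Proof.
move=> cf; apply: (@measurable_funS _ _ _ _ setT) => //.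
apply: (measurability _ (RGenOInfty.measurableE R)).
move=> _ [_ [a ->] <-]; rewrite setTI; apply: open_measurable_rV.
by move/continuousP : cf; apply; exact: interval_open.
Qed.

End borel.

Section unit_ball.
Context {R : realType} (m : nat).
Local Notation mu := (lebesgue_rV m : {measure set 'rV[R]_m -> \bar R}).
Local Notation B := (B1 m : set 'rV[R]_m).

Lemma Ck_sqr_norm r : Ck r (fun x : 'rV[R]_m => \sum_k x ord0 k ^+ 2).
Proof. by apply: Ck_sum => k; apply: CkM; exact: Ck_coord. Qed.

Lemma measurable_B1 : measurable B.
Proof.
apply: open_measurable_rV.
have /continuousP/(_ `]-oo, 1[%classic) := Ck_continuous (Ck_sqr_norm 0).
rewrite (_ : _ @^-1` _ = B); first by apply; exact: interval_open.
by apply/seteqP; split => x /=; rewrite in_itv.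
Qed.

Lemma sqr_coord_le (c : R) (x : 'rV[R]_m) k :
  \sum_k x ord0 k ^+ 2 <= c -> x ord0 k ^+ 2 <= c.
Proof.
apply: le_trans; rewrite (bigD1 k)//= lerDl; apply: sumr_ge0 => i _.
exact: sqr_ge0.
Qed.

Lemma B1_coord_le1 (x : 'rV[R]_m) k : \sum_k x ord0 k ^+ 2 <= 1 -> -1 <= x ord0 k <= 1.
Proof.
move=> /(sqr_coord_le k); rewrite -ler_norml => h.
by rewrite -(ler_pXn2r (isT : (0 < 2)%N)) ?nnegrE// expr1n real_normK ?num_real.
Qed.

Lemma compact_cube : compact [set x : 'rV[R]_m | forall k, `[(-1), 1]%classic (x ord0 k)].
Proof.
have := @rV_compact R m (fun=> `[(-1), 1]%classic)
  (fun=> @segment_compact R _ _).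
exact.
Qed.

Lemma B1_cube : B `<=` [set x : 'rV[R]_m | forall k, `[(-1), 1]%classic (x ord0 k)].
Proof. by move=> x Bx k /=; rewrite in_itv/= B1_coord_le1// ltW. Qed.

Lemma lebesgue_B1_lty : (mu B < +oo)%E.
Proof.
pose cube := [set x : 'rV[R]_m | forall k, `[(-1)%R, 1%R]%classic (x ord0 k)].
apply: (@le_lt_trans _ _ (mu cube)).
  apply: le_measure; rewrite ?inE.
  - exact: measurable_B1.
  - exact: compact_measurable_rV compact_cube.
  - exact: B1_cube.
have -> : (mu cube = \prod_(k < m) lebesgue_measure `[(-1)%R, 1%R]%classic)%E.
  exact: (@lebesgue_rV_box R m (fun=> `[(-1), 1]%classic)).
rewrite lebesgue_measure_itv/= lte_fin ifT; last by lra.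
by rewrite -EFinD prodEFin ltry.
Qed.

(** The ball lies in a compact cube.  This makes multiplication by any smooth
    function bounded on square-integrable functions, without cut-off. *)
Lemma continuous_bounded_B1 (f : 'rV[R]_m -> R) : continuous f ->
  exists2 M : R, 0 <= M & forall x, B x -> `|f x| <= M.
Proof.
move=> cf.
have /compact_bounded[M [_ Mf]] :=
  continuous_compact (continuous_subspaceT cf) compact_cube.
exists (`|M| + 1); first by rewrite addr_ge0.
move=> x /B1_cube Bx; apply: Mf; last by exists x.
by rewrite (le_lt_trans (ler_norm _))// ltrDl.
Qed.
End unit_ball.

Section square_integrable.
Context {R : realType} (m : nat).
Local Notation mu := (lebesgue_rV m : {measure set 'rV[R]_m -> \bar R}).
Local Notation B := (B1 m : set 'rV[R]_m).
Local Notation ig f := (mu.-integrable B (EFin \o f)).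
Implicit Types a f g : 'rV[R]_m -> R.

Lemma L2_mul_integrable f g : L2 f -> L2 g -> ig (fun x => f x * g x).
Proof.
move=> [mf f2] [mg g2].
have mB := @measurable_B1 R m.
apply: (le_integrable mB) (integrableD mB f2 g2).
  by apply/measurable_EFinP; exact: measurable_funM.
move=> x _; rewrite /= lee_fin normrM.
rewrite (@ger0_norm _ (_ + _)) ?addr_ge0 ?sqr_ge0//.
rewrite -(real_normK (num_real (f x))) -(real_normK (num_real (g x))).
set a := `|f x|; set b := `|g x|.
have a0 : 0 <= a by rewrite /a normr_ge0.
have b0 : 0 <= b by rewrite /b normr_ge0.
nra.
Qed.

Lemma L2_continuous f : continuous f -> L2 f.
Proof.
move=> cf; have mf : measurable_fun B f by exact: continuous_measurable_rV.
have [M M0 Mf] := continuous_bounded_B1 cf.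
split => //; apply: measurable_bounded_integrable.
- exact: measurable_B1.
- exact: lebesgue_B1_lty.
- exact: measurable_funX.
exists (M ^+ 2); split; first exact: num_real.
move=> y My x Bx; rewrite /= (le_trans _ (ltW My))//.
by rewrite normrX ler_pXn2r ?nnegrE// Mf.
Qed.

Lemma L2_integrable f : L2 f -> ig f.
Proof.
move=> f2; have := L2_mul_integrable f2 (L2_continuous (@cst_continuous _ R^o 1)).
by apply: eq_integrable => [|x _ /=]; [exact: measurable_B1|rewrite mulr1].
Qed.

Lemma L2D f g : L2 f -> L2 g -> L2 (fun x => f x + g x).
Proof.
move=> f2 g2; have mB := @measurable_B1 R m.
have fg := L2_mul_integrable f2 g2.
move: f2 g2 => [mf f2] [mg g2]; split; first exact: measurable_funD.
have := integrableD mB (integrableD mB f2 g2) (integrableZl mB 2 fg).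
apply: eq_integrable => // x _ /=; congr (_%:E); ring.
Qed.

Lemma L2_mul_continuous a f : continuous a -> L2 f -> L2 (fun x => a x * f x).
Proof.
move=> ca [mf f2]; have mB := @measurable_B1 R m.
have ma : measurable_fun B a by exact: continuous_measurable_rV.
have [M M0 Ma] := continuous_bounded_B1 ca.
split; first exact: measurable_funM.
apply: (le_integrable mB) (integrableZl mB (M ^+ 2) f2).
  by apply/measurable_EFinP/measurable_funX; exact: measurable_funM.
move=> x Bx; rewrite /= lee_fin !normrX ?normrM ?exprMn (ger0_norm M0) -!expr2.
by rewrite ler_wpM2r ?sqr_ge0// ler_pXn2r ?nnegrE// Ma.
Qed.

Lemma L2Z (c : R) f : L2 f -> L2 (fun x => c * f x).
Proof. by apply: L2_mul_continuous; exact: cst_continuous. Qed.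

End square_integrable.

(** * The fundamental lemma of the calculus of variations *)

Section fundamental_lemma.
Context {R : realType} (m : nat).
Local Notation mu := (lebesgue_rV m : {measure set 'rV[R]_m -> \bar R}).
Local Notation B := (B1 m : set 'rV[R]_m).
Local Notation ig f := (mu.-integrable B (EFin \o f)).
Implicit Types f g h phi : 'rV[R]_m -> R.

Lemma derivative_closed_flat : derivative_closed (range (@flat R)).
Proof.
move=> _ [P _ <-]; exists (flat ('X^2 * (P - P^`()))); last exact: is_derive_flat.
by eexists.
Qed.

Lemma smooth_flat P h : smooth h -> smooth (flat P \o h).
Proof. by move=> sh r; apply: (Ck_comp derivative_closed_flat). Qed.

Lemma derivative_closed_expR :
  derivative_closed [set F | exists b c : R, F = fun x => b * expR (c * x)].
Proof.
move=> _ [b [c ->]]; exists (fun x => (b * c) * expR (c * x)).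
  by exists (b * c), c.
move=> x.
have dc : is_derive x 1 (fun x : R => c * x) c.
  have := @is_deriveZ R R R id c x 1 1 (is_derive_id _ _).
  by rewrite /GRing.scale/= mulr1.
have dE := @is_derive1_comp R (@expR R) (fun x => c * x) x _ _ (is_derive_expR _) dc.
have := @is_deriveZ _ _ _ _ b x 1 _ dE.
by rewrite /GRing.scale/= (mulrC (expR _)) mulrA.
Qed.

(** The flat factor vanishes outside the ball of squared radius 1 - 1/(N+1), which
    makes the support compact in the unit ball; x |-> 1 - exp (- N x) saturates the
    positive values at 1 as N grows. *)
Definition bump (h : 'rV[R]_m -> R) (N : nat) (x : 'rV[R]_m) : R :=
  1 - expR (- N%:R *
      (flat 1 ((1 - N.+1%:R^-1) - \sum_k x ord0 k ^+ 2) * h x)).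

Section bump.
Variable h : 'rV[R]_m -> R.
Hypotheses (sh : smooth h) (h0 : forall x, 0 <= h x).

Let beta (N : nat) (x : 'rV[R]_m) : R :=
  flat 1 ((1 - N.+1%:R^-1) - \sum_k x ord0 k ^+ 2) * h x.

Let beta_ge0 N x : 0 <= beta N x.
Proof. by rewrite mulr_ge0// flat1_ge0. Qed.

Lemma bump_ge0_le1 N x : 0 <= bump h N x <= 1.
Proof.
rewrite /bump -/(beta N x) subr_ge0 expR_le1 mulNr oppr_le0 mulr_ge0//=.
Qed.

Lemma bump_le0 N x : h x <= 0 -> bump h N x = 0.
Proof.
move=> hx; rewrite /bump (_ : h x = 0); last by apply/eqP; rewrite eq_le hx h0.
by rewrite !mulr0 expR0 subrr.
Qed.

Lemma smooth_bump N : smooth (bump h N).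
Proof.
move=> r; apply: CkD; first exact: Ck_cst.
have -> : (fun x => - expR (- N%:R * beta N x)) =
    (fun y => -1 * expR (- N%:R * y)) \o beta N.
  by apply/funext => x /=; rewrite mulN1r.
apply: (Ck_comp derivative_closed_expR); first by eexists; eexists.
apply: CkM; last exact: sh.
pose w (x : 'rV[R]_m) : R := (1 - N.+1%:R^-1) + -1 * \sum_(k < m) x ord0 k ^+ 2.
have -> : (fun x : 'rV[R]_m =>
    flat 1 ((1 - N.+1%:R^-1) - \sum_k x ord0 k ^+ 2)) = flat 1 \o w.
  by apply/funext => x; rewrite /w/= mulN1r.
apply: smooth_flat => q; apply: CkD; first exact: Ck_cst.
exact/CkZ/Ck_sqr_norm.
Qed.

Lemma supp_bump N : supp (bump h N) `<=`
  [set x : 'rV[R]_m | \sum_k x ord0 k ^+ 2 <= 1 - N.+1%:R^-1].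
Proof.
rewrite /supp closureE => x; apply; split.
  have /continuousP/(_ `]1 - N.+1%:R^-1, +oo[%classic) :=
    Ck_continuous (@Ck_sqr_norm R m 0).
  move=> /(_ (interval_open _ _)) /open_closedC => H.
  rewrite (_ : [set _ | _] = ~` ((fun x : 'rV[R]_m =>
      \sum_(k < m) x ord0 k ^+ 2) @^-1` `]1 - N.+1%:R^-1, +oo[)).
    exact: H.
  by apply/seteqP; split => y /=; rewrite in_itv/= andbT leNgt => /negP.
move=> y /=; apply: contraNT; rewrite -ltNge => yN.
(* beyond the radius the flat factor is evaluated at a nonpositive number *)
rewrite /bump flat_le0 ?mul0r ?mulr0 ?expR0 ?subrr//.
by rewrite subr_le0 ltW.
Qed.

Lemma test_function_bump N : test_function (bump h N).
Proof.
split; first exact: smooth_bump.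
  apply: (subclosed_compact _ (@compact_cube R m)); first exact: closed_closure.
  move=> x /supp_bump/= xN k; rewrite /= in_itv/= B1_coord_le1//.
  by rewrite (le_trans xN)// gerBl invr_ge0.
move=> x /supp_bump; rewrite /B1/= => xN; apply: le_lt_trans xN _.
by rewrite gtrBl invr_gt0.
Qed.

Lemma bump_cvg x : B x -> bump h n x @[n --> \oo] --> ((0 < h x)%R%:R : R).
Proof.
move=> Bx; have [hx|hx] := ltP 0 (h x); last first.
  by under eq_fun do rewrite bump_le0//; exact: cvg_cst.
pose b := flat 1 (1 - \sum_k x ord0 k ^+ 2) * h x.
have b0 : 0 < b by rewrite mulr_gt0// flat1_gt0// subr_gt0.
have bN : beta n x @[n --> \oo] --> b.
  apply: cvgM; last exact: cvg_cst.
  apply: continuous_cvg.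
    have S1 : range (@flat R) (flat 1) by exists 1.
    exact: (derivative_closed_continuous derivative_closed_flat S1).
  apply: cvgB; last exact: cvg_cst.
  rewrite -[X in _ --> X]subr0; apply: cvgB; first exact: cvg_cst.
  exact: cvg_harmonic.
rewrite -[X in _ --> X]subr0; apply: cvgB; first exact: cvg_cst.
apply/cvgr0Pnorm_le => e e0; near=> n.
rewrite ger0_norm ?expR_ge0// mulNr expRN -[leRHS]invrK.
rewrite lef_pV2 ?posrE ?expR_gt0 ?invr_gt0//.
apply: le_trans (expR_ge1Dx _); rewrite ler_wpDl//.
apply: (@le_trans _ _ (n%:R * (b / 2))); last first.
  rewrite ler_wpM2l//; near: n.
  by apply: (cvgr_ge _ bN); rewrite ltr_pdivrMr// ltr_pMr// ltr1n.
rewrite -ler_pdivrMr ?divr_gt0//; near: n; exact: nbhs_infty_ger.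
Unshelve. all: by end_near. Qed.
End bump.

(** Dominated convergence along the bumps of h, which converge to the indicator
    of the set where h is positive. *)
Lemma integral_eq0_smooth_gt0 g h : L2 g -> smooth h -> (forall x, 0 <= h x) ->
  (forall phi, test_function phi -> \int[mu]_(x in B) (g x * phi x) = 0) ->
  (\int[mu]_(x in B `&` [set x | (0 < h x)%R]) (g x)%:E = 0)%E.
Proof.
move=> g2 sh h0 g0; have mB := @measurable_B1 R m.
rewrite integral_mkcondr.
have mA : measurable [set x | 0 < h x].
  apply: open_measurable_rV.
  have /continuousP/(_ `]0, +oo[%classic) := Ck_continuous (sh 0%N).
  rewrite (_ : _ @^-1` _ = [set x | 0 < h x]); first by apply; exact: interval_open.
  by apply/seteqP; split => x /=; rewrite in_itv/= andbT.
have gi := L2_integrable g2.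
have Cb N : continuous (bump h N) := Ck_continuous (smooth_bump sh N 0).
have := @dominated_convergence _ _ R mu B mB
  (fun N x => (g x * bump h N x)%:E) ((EFin \o g) \_ [set x | 0 < h x])
  (fun x => `|g x|%:E).
case.
- move=> N; apply/measurable_EFinP/measurable_funM; first by case: g2.
  exact: continuous_measurable_rV.
- apply/(measurable_restrict _ mA mB).
  apply: (measurable_funS mB); first exact: subIsetl.
  exact: measurable_int gi.
- apply: aeW => x Bx; rewrite restrict_EFin.
  apply: cvg_EFin; first exact: nearW.
  have := bump_cvg h0 Bx => /(cvgM (cvg_cst (g x))).
  rewrite (_ : g x * _ = (g \_ [set x | 0 < h x]) x); first exact.
  rewrite patchE; case: ifPn => [|/negP]; rewrite inE/= => hx.
    by rewrite hx mulr1.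
  by rewrite (negbTE (introN idP hx)) mulr0.
- exact: integrable_norm.
- apply: aeW => x N Bx; rewrite lee_fin normrM ler_piMr//.
  by have /andP[b0 b1] := bump_ge0_le1 h0 N x; rewrite ger0_norm.
move=> _ _ lim_bump; rewrite -(cvg_lim _ lim_bump)//.
rewrite (_ : [sequence _]_n = cst 0%E) ?lim_cst//.
apply/funext => N /=.
have H := congr1 EFin (g0 _ (test_function_bump sh N)).
rewrite -[RHS]H /Rintegral fineK//; apply: integrable_fin_num => //.
by apply: L2_mul_integrable => //; exact: L2_continuous.
Qed.

(** These sets serve as a generating pi-system; products of functions replace the
    explicit approximation of boxes. *)
Definition positivity_set : set (set 'rV[R]_m) :=
  [set A | exists h, [/\ smooth h, forall x, 0 <= h x & A = [set x | 0 < h x]]].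

Lemma positivity_set_setI : setI_closed positivity_set.
Proof.
move=> _ _ [f [sf f0 ->]] [g [sg g0 ->]]; exists (fun x => f x * g x); split.
- by move=> r; exact: CkM.
- by move=> x; rewrite mulr_ge0.
apply/seteqP; split => x /=; first by move=> [fx gx]; rewrite mulr_gt0.
have [->|fx] := eqVneq (f x) 0; first by rewrite mul0r ltxx.
have [->|gx] := eqVneq (g x) 0; first by rewrite mulr0 ltxx.
by rewrite !lt_def fx gx f0 g0.
Qed.

(** The half-space x_j > a is where flat 1 (x_j - a) is positive. *)
Lemma measurable_positivity_set (A : set 'rV[R]_m) :
  measurable A -> <<s positivity_set >> A.
Proof.
apply: smallest_sub; first exact: smallest_sigma_algebra.
move=> _ [i [j [Y mY ->]]].
have mcoord : measurable_fun setT
    (fun x : g_sigma_algebraType positivity_set => (x : 'rV[R]_m) i j).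
  apply: (measurability _ (RGenOInfty.measurableE R)).
  move=> _ [_ [a ->] <-]; rewrite setTI; apply: sub_sigma_algebra.
  pose w (x : 'rV[R]_m) : R := x ord0 j + - a.
  (* flat 1 is positive exactly on the positive reals *)
  exists (flat 1 \o w); split.
  - apply: smooth_flat => r; apply: CkD; [exact: Ck_coord|exact: Ck_cst].
  - by move=> x; exact: flat1_ge0.
  apply/seteqP; split => x /=; rewrite in_itv/= andbT ord1 => xa.
    by rewrite flat1_gt0// subr_gt0.
  by rewrite ltNge; apply/negP => ax; move: xa; rewrite flat_le0 ?ltxx// subr_le0.
by have := mcoord measurableT _ mY; rewrite setTI.
Qed.

(** The measurable sets whose trace on the ball has integral 0 under g form a Dynkin
    system containing the pi-system of positivity sets. *)
Lemma fundamental_lemma g : L2 g ->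
  (forall phi, test_function phi -> \int[mu]_(x in B) (g x * phi x) = 0) ->
  ae_eq mu B g (fun=> 0).
Proof.
move=> g2 g0; have mB := @measurable_B1 R m; have gi := L2_integrable g2.
pose H : set (set 'rV[R]_m) :=
  [set A | measurable A /\ (\int[mu]_(x in B `&` A) (g x)%:E = 0)%E].
have HG : positivity_set `<=` H.
  move=> A [h [sh h0 AE]]; split; last by rewrite AE; exact: integral_eq0_smooth_gt0.
  have /continuousP/(_ `]0, +oo[%classic) := Ck_continuous (sh 0%N).
  rewrite AE (_ : _ @^-1` _ = [set x | 0 < h x]); last first.
    by apply/seteqP; split => x /=; rewrite in_itv/= andbT.
  by move=> /(_ (interval_open _ _)) /open_measurable_rV; exact.
have HT : H setT.
  apply: HG; exists (fun=> 1); split => //; first by move=> r; exact: Ck_cst.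
  by apply/seteqP; split => // x _ /=.
have dH : dynkin H.
  split => //.
    move=> A [mA A0]; split; first exact: measurableC.
    have mBA : measurable (B `&` A) by exact: measurableI.
    have mBcA : measurable (B `&` ~` A) by apply: measurableI => //; exact: measurableC.
    have : (\int[mu]_(x in B `&` A `|` B `&` ~` A) (g x)%:E = 0)%E.
      by rewrite -setIUr setUv; exact: HT.2.
    rewrite (@integral_setU_EFin _ _ _ mu)//.
    - by rewrite A0 add0e.
    - by rewrite -setIUr setUv setIT; case: g2.
    - by apply/disj_setPS => x [[_ Ax] [_]].
  move=> F tF HF; split; first by apply: bigcupT_measurable => n; case: (HF n).
  rewrite setI_bigcupr integral_bigcup.
  - by apply: eseries0 => n _ _; case: (HF n).
  - by apply: trivIset_setIl.
  - by move=> n; apply: measurableI => //; case: (HF n).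
  rewrite -setI_bigcupr; apply: integrableS gi => //.
  by apply: measurableI => //; apply: bigcupT_measurable => n; case: (HF n).
have HM A : measurable A -> H A.
  move=> /measurable_positivity_set.
  rewrite -(setI_closed_g_dynkin_g_sigma_algebra positivity_set_setI).
  by apply: smallest_sub.
have : ae_eq mu B (EFin \o g) (cst 0%E).
  apply: integral_ae_eq => //.
  move=> E EB mE; rewrite integral0.
  by have [_] := HM _ mE; rewrite setIidr.
by apply: filterS => x + Bx => /(_ Bx) /= [].
Qed.

Lemma weak_partial_unique k f g1 g2 : L2 g1 -> L2 g2 ->
  weak_partial k f g1 -> weak_partial k f g2 -> ae_eq mu B g1 g2.
Proof.
move=> L1 L2' w1 w2; have mB := @measurable_B1 R m.
(* written with a scalar multiple so that closure lemmas for L2 apply directly *)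
have : ae_eq mu B (fun x => g1 x + -1 * g2 x) (fun=> 0).
  apply: fundamental_lemma; first by apply: L2D => //; exact: L2Z.
  move=> phi tphi; have Lphi : L2 phi.
    by case: tphi => sphi _ _; exact: L2_continuous (Ck_continuous (sphi 0%N)).
  under eq_Rintegral do rewrite mulrDl mulN1r mulNr.
  rewrite RintegralB//; [|exact: L2_mul_integrable..].
  apply/eqP; rewrite subr_eq0 -eqr_opp; apply/eqP.
  by rewrite -w1// -w2.
apply: filterS => x + Bx => /(_ Bx) /eqP; rewrite mulN1r subr_eq0 => /eqP.
exact.
Qed.

Lemma wpartialP k f : W12 f -> L2 (wpartial k f) /\ weak_partial k f (wpartial k f).
Proof.
move=> [_ /(_ k)[g Lg wg]].
by apply: (@xgetPex _ (fun=> 0) [set g | L2 g /\ weak_partial k f g]); exists g.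
Qed.

Lemma wpartial_ae k f g : L2 g -> weak_partial k f g -> ae_eq mu B (wpartial k f) g.
Proof.
move=> Lg wg.
have [L w] : [set g | L2 g /\ weak_partial k f g] (wpartial k f).
  by apply: (@xgetPex _ (fun=> 0) [set g | L2 g /\ weak_partial k f g]); exists g.
exact: weak_partial_unique wg.
Qed.

End fundamental_lemma.

(** * Trigonometric and hyperbolic rotations *)

Section rotation_pairs.
Context {R : realType}.
Implicit Types (s : R) (C D : R -> R).

(** Common interface of (cos, sin), for s = 1, and (cosh, sinh), for s = -1. *)
Definition rotation_pair s C D :=
  [/\ C 0 = 1, D 0 = 0, forall x : R, is_derive x 1 C (- s * D x),
      forall x : R, is_derive x 1 D (C x) & forall x, C x ^+ 2 + s * D x ^+ 2 = 1].

Lemma rotation_pair_cos_sin : rotation_pair 1 (@cos R) (@sin R).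
Proof.
split=> [||x|x|x]; [exact: cos0|exact: sin0| |exact: is_derive_sin|].
  by rewrite mulN1r; exact: is_derive_cos.
by rewrite mul1r cos2Dsin2.
Qed.

Lemma rotation_pair_cosh_sinh : exists C D, rotation_pair (-1) C D.
Proof.
pose C (x : R) := 2^-1 * (expR x + expR (- x)).
pose D (x : R) := 2^-1 * (expR x - expR (- x)).
have dE (x : R) : is_derive x 1 (fun x : R => expR (- x)) (- expR (- x)).
  have := @is_derive1_comp R (@expR R) -%R x _ _ (is_derive_expR _) (is_deriveNid _ _).
  by rewrite mulrN1.
exists C, D; split=> [||x|x|x].
- by rewrite /C oppr0 expR0; lra.
- by rewrite /D oppr0 expR0 subrr mulr0.
- have := is_deriveZ (2^-1) (is_deriveD (is_derive_expR x) (dE x)).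
  by move=> H; apply: (is_derive_eq H); rewrite opprK mul1r.
- have := is_deriveZ (2^-1) (is_deriveB (is_derive_expR x) (dE x)).
  by move=> H; apply: (is_derive_eq H); rewrite opprK.
- rewrite /C /D expRN; have := expR_gt0 x; move: (expR x) => e e0.
  by field; rewrite gt_eqF.
Qed.

Lemma rotation_pair_exists s : s = 1 \/ s = -1 -> exists C D, rotation_pair s C D.
Proof.
by move=> [->|->]; [exists cos, sin; exact: rotation_pair_cos_sin
                  |exact: rotation_pair_cosh_sinh].
Qed.

Lemma derivative_closed_rotation_pair s C D : rotation_pair s C D ->
  derivative_closed [set F | exists a b : R, F = fun x => a * C x + b * D x].
Proof.
move=> [_ _ dC dD _] _ [a [b ->]].
exists (fun x => b * C x + (- (a * s)) * D x); first by exists b, (- (a * s)).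
move=> x; have H := is_deriveD (is_deriveZ a (dC x)) (is_deriveZ b (dD x)).
by apply: (is_derive_eq H); rewrite /GRing.scale/=; ring.
Qed.

(** Mean value theorem on the segment between 0 and x, for either sign of x. *)
Lemma mean_value_from0 (F dF : R -> R) x : (forall y : R, is_derive y 1 F (dF y)) ->
  exists2 c, `|c| <= `|x| & F x - F 0 = dF c * x.
Proof.
move=> FdF.
have cF : continuous F.
  by move=> y; apply/differentiable_continuous/derivable1_diffP; case: (FdF y).
have [x0|x0] := leP 0 x.
  have [c cx E] := MVT_segment x0 (fun y _ => FdF y) (continuous_subspaceT cF).
  exists c; last by rewrite E subr0.
  by move: cx; rewrite in_itv/= => /andP[c0 cx]; rewrite !ger0_norm.
have [c cx E] := MVT_segment (ltW x0) (fun y _ => FdF y) (continuous_subspaceT cF).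
exists c; last by rewrite -opprB E sub0r mulrN opprK.
move: cx; rewrite in_itv/= => /andP[c0 cx].
by rewrite ler0_norm// ltr0_norm// lerN2.
Qed.

(** C is bounded on [-1, 1] by continuity; integrating the differential equations
    from 0 with the mean value theorem gives the three bounds in turn. *)
Lemma rotation_pair_estimates s C D : rotation_pair s C D -> `|s| <= 1 ->
  exists2 K, 0 <= K & forall x, `|x| <= 1 ->
    [/\ `|C x - 1| <= K * `|x| ^+ 2, `|D x| <= K * `|x|
      & `|D x - x| <= K * `|x| ^+ 2].
Proof.
move=> [C0 D0 dC dD _] s1.
have cC : continuous C.
  by move=> y; apply/differentiable_continuous/derivable1_diffP; case: (dC y).
have := continuous_compact (continuous_subspaceT cC) (@segment_compact R (-1) 1).
move=> /compact_bounded[M [_ MC]].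
pose K := `|M| + 1; have K0 : 0 <= K by rewrite addr_ge0.
have CK x : `|x| <= 1 -> `|C x| <= K.
  move=> x1; apply: MC; first by rewrite (le_lt_trans (ler_norm _))// ltrDl.
  by exists x => //=; rewrite in_itv/= -ler_norml.
have DK x : `|x| <= 1 -> `|D x| <= K * `|x|.
  move=> x1; have [c cx E] := mean_value_from0 x dD.
  by move: E; rewrite D0 subr0 => ->; rewrite normrM ler_wpM2r// CK// (le_trans cx).
have C1 x : `|x| <= 1 -> `|C x - 1| <= K * `|x| ^+ 2.
  move=> x1; have [c cx E] := mean_value_from0 x dC.
  rewrite -C0 E normrM expr2 mulrA ler_wpM2r// normrM normrN.
  apply: (@le_trans _ _ `|D c|); first by rewrite ler_piMl.
  by rewrite (le_trans (DK _ (le_trans cx x1)))// ler_wpM2l.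
exists K => // x x1; split; [exact: C1|exact: DK|].
have [c cx E] : exists2 c, `|c| <= `|x| & D x - x = (C c - 1) * x.
  have dDx (y : R) : is_derive y 1 (fun z => D z - z) (C y - 1).
    exact: (is_deriveB (dD y) (is_derive_id y 1)).
  have [c cx E] := mean_value_from0 x dDx; exists c => //.
  by rewrite -E D0 !subr0.
have c1 := le_trans cx x1.
rewrite E normrM expr2 mulrA ler_wpM2r// (le_trans (C1 _ c1))// ler_wpM2l//.
by rewrite expr2 (le_trans _ cx)// ler_piMl.
Qed.

End rotation_pairs.

(** * Rotations of a coordinate plane preserving the indefinite form *)

Section pseudorotation.
Context {R : realType} (n nu : nat).
Implicit Types (i j l : 'I_n.+1) (y z : 'I_n.+1 -> R) (c d : R).

Definition sgn l : R := if (l < nu)%N then -1 else 1.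

Definition plane_part i j y l : R := if (l == i) || (l == j) then y l else 0.

(** The infinitesimal isometry X = E (e_i e_j^T - e_j e_i^T). *)
Definition generator i j y l : R :=
  if l == i then sgn i * y j else if l == j then - (sgn j * y i) else 0.

(** Since X^2 = - (eps_i eps_j) P with P the projection onto the plane, the exponential
    of s X is 1 + (C(s) - 1) P + D(s) X for a rotation pair (C, D). *)
Definition pseudorotation i j c d y l : R :=
  y l + (c - 1) * plane_part i j y l + d * generator i j y l.

(** In the plane, the form is multiplied by c^2 + eps_i eps_j d^2. *)
Lemma sum_sgn_pseudorotation i j c d y : i != j ->
  c ^+ 2 + sgn i * sgn j * d ^+ 2 = 1 ->
  \sum_l sgn l * pseudorotation i j c d y l ^+ 2 = \sum_l sgn l * y l ^+ 2.
Proof.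
move=> ij cd; have ji : j != i by rewrite eq_sym.
rewrite (bigD1 i)//= (bigD1 j)//= [RHS](bigD1 i)//= [X in _ = _ + X](bigD1 j)//=.
rewrite !addrA; congr (_ + _); last first.
  apply: eq_bigr => l /andP[/negPf li /negPf lj].
  by rewrite /pseudorotation /plane_part /generator li lj !mulr0 !addr0.
rewrite /pseudorotation /plane_part /generator !eqxx (negPf ji) /=.
transitivity ((c ^+ 2 + sgn i * sgn j * d ^+ 2) *
   (sgn i * y i ^+ 2 + sgn j * y j ^+ 2)); last by rewrite cd mul1r.
by rewrite /sgn; do 2 case: ifP => _; rewrite /=; ring.
Qed.

Lemma sum_sgn_generator i j y z : i != j ->
  \sum_l sgn l * (z l * generator i j y l) = z i * y j - z j * y i.
Proof.
move=> ij; have ji : j != i by rewrite eq_sym.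
rewrite (bigD1 i)//= (bigD1 j)//= big1 ?addr0; last first.
  move=> l /andP[/negPf li /negPf lj].
  by rewrite /generator li lj !mulr0.
rewrite /generator !eqxx (negPf ji).
by rewrite /sgn; do 2 case: ifP => _; rewrite /=; ring.
Qed.

(** On the left is the derivative of a rotation with varying angle applied to y,
    where z is the derivative of y and e that of the angle.  The derivative of
    the rotation is the rotation composed with X, so the rotation factors out. *)
Lemma pseudorotation_gradient i j c d e y z l : i != j ->
  pseudorotation i j c d z l + e * (- (sgn i * sgn j) * d * plane_part i j y l
    + c * generator i j y l)
  = pseudorotation i j c d (fun l => z l + e * generator i j y l) l.
Proof.
move=> ij; have ji : j != i by rewrite eq_sym.
rewrite /pseudorotation /plane_part /generator !eqxx (negPf ji).
have [->|li] := eqVneq l i; first by rewrite /= ?(negPf ij); ring.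
by have [->|lj] := eqVneq l j; rewrite /=; ring.
Qed.

End pseudorotation.

(** * Calculus of weak gradients *)

Section weak_gradient.
Context {R : realType} (m : nat).
Local Notation mu := (lebesgue_rV m : {measure set 'rV[R]_m -> \bar R}).
Local Notation B := (B1 m : set 'rV[R]_m).
Local Notation ig f := (mu.-integrable B (EFin \o f)).
Implicit Types (a b f g phi : 'rV[R]_m -> R) (G H : 'I_m -> 'rV[R]_m -> R).

(** All first weak derivatives at once, with explicit representatives: the product
    rule is stated for these, and the chosen representatives are recovered
    almost everywhere by [weak_gradient_ae]. *)
Definition weak_gradient f G :=
  L2 f /\ forall k, L2 (G k) /\ weak_partial k f (G k).

Lemma weak_gradient_W12 f G : weak_gradient f G -> W12 f.
Proof. by move=> [f2 fG]; split=> // k; have [G2 w] := fG k; exists (G k). Qed.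

Lemma W12_weak_gradient f : W12 f -> weak_gradient f (fun k => wpartial k f).
Proof. by move=> Wf; split; [case: Wf|move=> k; exact: wpartialP]. Qed.

Lemma weak_gradient_ae f G : weak_gradient f G ->
  {ae mu, forall x, B x -> forall k, wpartial k f x = G k x}.
Proof.
move=> [_ fG].
have : {ae mu, forall x k, B x -> wpartial k f x = G k x}.
  by apply: filter_forall => k; have [G2 w] := fG k; exact: wpartial_ae.
by apply: filterS => x h Bx k; exact: h.
Qed.

Lemma smooth_continuous a : smooth a -> continuous a.
Proof. by move=> sa; exact: (Ck_continuous (sa 0%N)). Qed.

Lemma smooth_partial k a : smooth a -> smooth (partial k a).
Proof. by move=> sa r; case: (sa r.+1) => _ _; exact. Qed.

Lemma smooth_derivable a x k : smooth a -> derivable a x (delta_mx ord0 k).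
Proof. by move=> sa; case: (sa 1%N) => _ + _; exact. Qed.

Lemma smoothM a b : smooth a -> smooth b -> smooth (fun x => a x * b x).
Proof. by move=> sa sb r; exact: CkM. Qed.

Lemma smoothD a b : smooth a -> smooth b -> smooth (fun x => a x + b x).
Proof. by move=> sa sb r; exact: CkD. Qed.

Lemma smooth_cst (c : R) : smooth (fun _ : 'rV[R]_m => c).
Proof. by move=> r; exact: Ck_cst. Qed.

Lemma partialD_cst k a (c : R) x : smooth a ->
  partial k (fun x : 'rV[R]_m => a x + c) x = partial k a x.
Proof.
move=> sa; rewrite /partial (deriveD (smooth_derivable sa))//.
by rewrite derive_cst addr0.
Qed.

Lemma test_functionM a phi : smooth a -> test_function phi ->
  test_function (fun x => a x * phi x).
Proof.
move=> sa [sphi cphi Bphi].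
have sub : supp (fun x => a x * phi x) `<=` supp phi.
  apply: closureS => x /=; apply: contra_neq => ->; exact: mulr0.
split; first exact: smoothM.
  by apply: subclosed_compact cphi sub; exact: closed_closure.
exact: subset_trans sub Bphi.
Qed.

Lemma test_function_smooth phi : test_function phi -> smooth phi.
Proof. by case. Qed.

Lemma L2_smooth a : smooth a -> L2 a.
Proof. by move=> /smooth_continuous; exact: L2_continuous. Qed.

Lemma weak_gradient0 : weak_gradient (fun=> 0) (fun _ _ => 0).
Proof.
have L0 : L2 (fun _ : 'rV[R]_m => 0 : R) by apply: L2_continuous; exact: cst_continuous.
split => // k; split => // phi tphi.
by under eq_Rintegral do rewrite mul0r; under [in RHS]eq_Rintegral do rewrite mul0r;
  rewrite Rintegral_cst ?mul0r ?oppr0//; exact: measurable_B1.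
Qed.

Lemma weak_gradientD f g G H : weak_gradient f G -> weak_gradient g H ->
  weak_gradient (fun x => f x + g x) (fun k x => G k x + H k x).
Proof.
move=> [f2 fG] [g2 gH]; split; first exact: L2D.
move=> k; have [G2 wG] := fG k; have [H2 wH] := gH k; split; first exact: L2D.
move=> phi tphi; have sphi := test_function_smooth tphi.
have p2 := L2_smooth sphi; have dp2 := L2_smooth (smooth_partial k sphi).
have mB := @measurable_B1 R m.
under eq_Rintegral do rewrite mulrDl.
under [in RHS]eq_Rintegral do rewrite mulrDl.
rewrite !RintegralD//; do ?exact: L2_mul_integrable.
by rewrite wG// wH// opprD.
Qed.

(** If phi is a test function, so is a phi; test f against it and apply the
    classical product rule. *)
Lemma weak_gradientM a f G : smooth a -> weak_gradient f G ->
  weak_gradient (fun x => a x * f x) (fun k x => a x * G k x + partial k a x * f x).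
Proof.
move=> sa [f2 fG].
have La g : L2 g -> L2 (fun x => a x * g x).
  by apply: L2_mul_continuous; exact: smooth_continuous.
have Lda k g : L2 g -> L2 (fun x => partial k a x * g x).
  by apply: L2_mul_continuous; exact/smooth_continuous/smooth_partial.
split; first exact: La.
move=> k; have [G2 wG] := fG k; split; first by apply: L2D; [exact: La|exact: Lda].
move=> phi tphi; have sphi := test_function_smooth tphi.
have p2 := L2_smooth sphi; have dp2 := L2_smooth (smooth_partial k sphi).
have mB := @measurable_B1 R m.
have tap := test_functionM sa tphi.
have dap2 := L2_smooth (smooth_partial k (test_function_smooth tap)).
under [LHS]eq_Rintegral => x _.
  rewrite (_ : a x * f x * partial k phi x =
    f x * partial k (fun y => a y * phi y) x - partial k a x * f x * phi x); last first.
    by rewrite partialM; [ring|exact: smooth_derivable|exact: smooth_derivable].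
  over.
under [in RHS]eq_Rintegral => x _.
  rewrite (_ : (a x * G k x + partial k a x * f x) * phi x =
    G k x * (a x * phi x) + partial k a x * f x * phi x); last by ring.
  over.
have i1 := L2_mul_integrable (Lda k _ f2) p2.
rewrite RintegralB//; last exact: L2_mul_integrable.
rewrite RintegralD//; last exact: (L2_mul_integrable G2 (La _ p2)).
by rewrite wG// opprD.
Qed.

Lemma weak_gradientZ (c : R) f G : weak_gradient f G ->
  weak_gradient (fun x => c * f x) (fun k x => c * G k x).
Proof.
move=> fG; have sc : smooth (fun _ : 'rV[R]_m => c) by move=> r; exact: Ck_cst.
have := weak_gradientM sc fG.
rewrite (_ : (fun k x => _ + _) = (fun k x => c * G k x)) //.
by apply/funext => k; apply/funext => x; rewrite partial_cst mul0r addr0.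
Qed.

Lemma integrable_Rsum (I : Type) (s : seq I) (F : I -> 'rV[R]_m -> R) :
  (forall i, ig (F i)) -> ig (fun x => \sum_(i <- s) F i x).
Proof.
move=> FI; have mB := @measurable_B1 R m.
have := integrable_sum mB s (P := xpredT) (h := fun i => EFin \o F i) (fun i _ => FI i).
by apply: eq_integrable => // x _ /=; rewrite sumEFin.
Qed.

Lemma Rintegral_ae_eq f g : measurable_fun B f -> measurable_fun B g ->
  ae_eq mu B f g -> \int[mu]_(x in B) f x = \int[mu]_(x in B) g x.
Proof.
move=> mf mg fg; congr fine; apply: ae_eq_integral.
- exact: measurable_B1.
- exact/measurable_EFinP.
- exact/measurable_EFinP.
- by apply: filterS fg => x /[apply] /= ->.
Qed.

End weak_gradient.

(** * The energy along a localized pseudo-rotation *)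

Section energy_density.
Context {R : realType} (m n nu : nat).
Local Notation mu := (lebesgue_rV m : {measure set 'rV[R]_m -> \bar R}).
Local Notation B := (B1 m : set 'rV[R]_m).
Local Notation ig f := (mu.-integrable B (EFin \o f)).
Local Notation sgn := (@sgn R n nu).
Implicit Types (u : 'rV[R]_m -> 'cV[R]_n.+1) (i j l : 'I_n.+1) (k : 'I_m).

Lemma psphereE (y : 'cV[R]_n.+1) :
  psphere nu y <-> \sum_l sgn l * y l ord0 ^+ 2 = 1.
Proof.
have E : (y^T *m Emx n nu *m y) ord0 ord0 = \sum_l sgn l * y l ord0 ^+ 2.
  rewrite mul_mx_diag mxE; apply: eq_bigr => l _.
  by rewrite !mxE -/(sgn l) expr2; ring.
rewrite -E /psphere/=; split=> [->|H]; first by rewrite mxE eqxx.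
by apply/matrixP => a b; rewrite !ord1 H mxE eqxx.
Qed.

Lemma trace_energyE (J : 'M[R]_(n.+1, m)) :
  \tr (J^T *m Emx n nu *m J) = \sum_k \sum_l sgn l * J l k ^+ 2.
Proof.
apply: eq_bigr => k _; rewrite mul_mx_diag mxE; apply: eq_bigr => l _.
by rewrite !mxE -/(sgn l) expr2; ring.
Qed.

Definition density (g : 'I_n.+1 -> 'I_m -> 'rV[R]_m -> R) (x : 'rV[R]_m) : R :=
  \sum_k \sum_l sgn l * g l k x ^+ 2.

Lemma integrable_density g : (forall l k, L2 (g l k)) -> ig (density g).
Proof.
move=> g2; apply: integrable_Rsum => k; apply: integrable_Rsum => l.
have := L2_mul_integrable (L2Z (sgn l) (g2 l k)) (g2 l k).
apply: eq_integrable => [|x _ /=]; first exact: measurable_B1.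
by congr (_%:E); rewrite expr2 mulrA.
Qed.

Lemma measurable_density g : (forall l k, L2 (g l k)) ->
  measurable_fun B (density g).
Proof. by move=> /integrable_density /measurable_int /measurable_EFinP. Qed.

Lemma jac_ae u G : (forall l, weak_gradient (component u l) (G l)) ->
  {ae mu, forall x, B x -> forall l k, jac u x l k = G l k x}.
Proof.
move=> uG.
have : {ae mu, forall x l, B x -> forall k, wpartial k (component u l) x = G l k x}.
  by apply: filter_forall => l; exact: weak_gradient_ae.
by apply: filterS => x h Bx l k; rewrite !mxE h.
Qed.

Lemma L2_jac u l k : vW12 u -> L2 (fun x => jac u x l k).
Proof.
move=> Wu; have [+ _] := wpartialP k (Wu l).
by congr L2; apply/funext => x; rewrite !mxE.
Qed.

(** The energy does not depend on the representatives of the weak gradient. *)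
Lemma energyE u G : (forall l, weak_gradient (component u l) (G l)) ->
  energy nu u = 2^-1 * \int[mu]_(x in B) density G x.
Proof.
move=> uG; congr (_ * _).
have Wu : vW12 u by move=> l; exact: weak_gradient_W12 (uG l).
under eq_Rintegral do rewrite trace_energyE.
apply: Rintegral_ae_eq.
- apply: (measurable_density (g := fun l k x => jac u x l k)) => l k.
  exact: L2_jac.
- apply: measurable_density => l k.
  by case: (uG l) => _ /(_ k)[].
apply: filterS (jac_ae uG) => x h Bx.
by apply: eq_bigr => k _; apply: eq_bigr => l _; rewrite h.
Qed.

End energy_density.

Section noether_current.
Context {R : realType} (m n : nat).
Local Notation mu := (lebesgue_rV m : {measure set 'rV[R]_m -> \bar R}).
Implicit Types (u : 'rV[R]_m -> 'cV[R]_n.+1) (i j : 'I_n.+1) (k : 'I_m).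

(** The conserved current attached to rotations of the (i, j)-plane. *)
Definition noether_current u i j (x : 'rV[R]_m) : 'rV[R]_m :=
  component u i x *: wgrad (component u j) x - component u j x *: wgrad (component u i) x.

Lemma integrable_noether_current u i j k : vW12 u ->
  mu.-integrable (B1 m) (EFin \o (fun x => noether_current u i j x ord0 k)).
Proof.
move=> Wu; have mB := @measurable_B1 R m.
have u2 l : L2 (component u l) by case: (Wu l).
have p2 l : L2 (wpartial k (component u l)) by case: (wpartialP k (Wu l)).
have := integrableB mB (L2_mul_integrable (u2 i) (p2 j)) (L2_mul_integrable (u2 j) (p2 i)).
by apply: eq_integrable => // x _ /=; rewrite !mxE.
Qed.

End noether_current.

Section variation.
Context {R : realType} (m n nu : nat).
Local Notation mu := (lebesgue_rV m : {measure set 'rV[R]_m -> \bar R}).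
Local Notation B := (B1 m : set 'rV[R]_m).
Local Notation ig f := (mu.-integrable B (EFin \o f)).
Local Notation sgn := (@sgn R n nu).
Local Notation generator := (@generator R n nu).
Local Notation pseudorotation := (@pseudorotation R n nu).
Context (u : 'rV[R]_m -> 'cV[R]_n.+1) (i j : 'I_n.+1) (phi : 'rV[R]_m -> R).
Context (C D : R -> R).
Hypotheses (Wu : vW12 u) (ij : i != j) (sphi : smooth phi).
Hypothesis CD : rotation_pair (sgn i * sgn j) C D.
Implicit Types (l : 'I_n.+1) (k : 'I_m) (t : R).

Let y (x : 'rV[R]_m) l : R := component u l x.
Let p k (x : 'rV[R]_m) l : R := wpartial k (component u l) x.

Definition variation t (x : 'rV[R]_m) : 'cV[R]_n.+1 :=
  \col_l pseudorotation i j (C (t * phi x)) (D (t * phi x)) (y x) l.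

Lemma weak_gradient_component l :
  weak_gradient (fun x => y x l) (fun k x => p k x l).
Proof. exact: (W12_weak_gradient (Wu l)). Qed.

Lemma weak_gradient_plane_part l :
  weak_gradient (fun x => plane_part i j (y x) l) (fun k x => plane_part i j (p k x) l).
Proof.
rewrite /plane_part; case: ((l == i) || (l == j)); [exact: weak_gradient_component|].
exact: weak_gradient0.
Qed.

Lemma weak_gradient_generator l :
  weak_gradient (fun x => generator i j (y x) l) (fun k x => generator i j (p k x) l).
Proof.
rewrite /generator; case: (l == i).
  exact/weak_gradientZ/weak_gradient_component.
case: (l == j); last exact: weak_gradient0.
have := weak_gradientZ (- sgn j) (weak_gradient_component i).
by under eq_fun do rewrite mulNr; under [X in weak_gradient _ X]eq_fun => k do
  under eq_fun do rewrite mulNr.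
Qed.

Lemma weak_gradient_combination a b l : smooth a -> smooth b ->
  weak_gradient
    (fun x => a x * plane_part i j (y x) l + b x * generator i j (y x) l)
    (fun k x => (a x * plane_part i j (p k x) l + partial k a x * plane_part i j (y x) l) +
      (b x * generator i j (p k x) l + partial k b x * generator i j (y x) l)).
Proof.
move=> sa sb; apply: weak_gradientD.
  exact: (weak_gradientM sa (weak_gradient_plane_part l)).
exact: (weak_gradientM sb (weak_gradient_generator l)).
Qed.

Let smooth_tphi t : smooth (fun x => t * phi x).
Proof. by move=> r; exact: CkZ. Qed.

Let partial_tphi t k x : partial k (fun x => t * phi x) x = t * partial k phi x.
Proof.
by rewrite partialZ//; exact: smooth_derivable.
Qed.

Lemma smooth_C t : smooth (fun x => C (t * phi x)).
Proof.
have SC : [set F | exists a b : R, F = fun x => a * C x + b * D x] C.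
  by exists 1, 0; apply/funext => x; rewrite mul1r mul0r addr0.
move=> r; exact: (Ck_comp (derivative_closed_rotation_pair CD) SC (smooth_tphi t r)).
Qed.

Lemma smooth_D t : smooth (fun x => D (t * phi x)).
Proof.
have SD : [set F | exists a b : R, F = fun x => a * C x + b * D x] D.
  by exists 0, 1; apply/funext => x; rewrite mul1r mul0r add0r.
move=> r; exact: (Ck_comp (derivative_closed_rotation_pair CD) SD (smooth_tphi t r)).
Qed.

Lemma partial_C t k x : partial k (fun x => C (t * phi x)) x =
  - (sgn i * sgn j) * D (t * phi x) * (t * partial k phi x).
Proof.
have [_ _ dC _ _] := CD; rewrite -partial_tphi.
by have [] := is_derive_comp_dir (dC (t * phi x))
  (@smooth_derivable R m _ x k (smooth_tphi t)).
Qed.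

Lemma partial_D t k x : partial k (fun x => D (t * phi x)) x =
  C (t * phi x) * (t * partial k phi x).
Proof.
have [_ _ _ dD _] := CD; rewrite -partial_tphi.
by have [] := is_derive_comp_dir (dD (t * phi x))
  (@smooth_derivable R m _ x k (smooth_tphi t)).
Qed.

Lemma weak_gradient_variation t l :
  weak_gradient (component (variation t) l)
   (fun k x => pseudorotation i j (C (t * phi x)) (D (t * phi x))
      (fun l => p k x l + t * partial k phi x * generator i j (y x) l) l).
Proof.
have sC1 : smooth (fun x => C (t * phi x) + -1).
  by apply: smoothD; [exact: smooth_C|exact: smooth_cst].
have := weak_gradientD (weak_gradient_component l)
  (weak_gradient_combination l sC1 (smooth_D t)).
congr weak_gradient.
  by apply/funext => x; rewrite /component mxE /pseudorotation addrA.
apply/funext => k; apply/funext => x.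
rewrite -pseudorotation_gradient// partialD_cst; last exact: smooth_C.
rewrite partial_C partial_D /pseudorotation; ring.
Qed.

(** By [pseudorotation_gradient] and the invariance of the form, the rotation drops
    out of the energy density, leaving that of grad u + t (grad phi) X u. The
    coefficient of t is minus the integral of grad phi against the current. *)
Lemma energy_variation : exists a c : R, forall t,
  energy nu (variation t) = a + t * distr_div (noether_current u i j) phi + t ^+ 2 * c.
Proof.
have mB := @measurable_B1 R m.
have cdphi k : continuous (partial k phi) := smooth_continuous (smooth_partial k sphi).
have p2 l k : L2 (fun x => p k x l).
  by case: (weak_gradient_component l) => _ /(_ k)[].
have g2 l k : L2 (fun x => partial k phi x * generator i j (y x) l).
  by apply: L2_mul_continuous => //; case: (weak_gradient_generator l).
(* the coefficients of 1, t and t^2 in the energy density, up to constants *)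
pose e0 := density nu (fun l k x => p k x l).
pose b := density nu (fun l k x => partial k phi x * generator i j (y x) l).
pose a x := \sum_k noether_current u i j x ord0 k * partial k phi x.
have e0i : ig e0 by exact: integrable_density.
have bi : ig b by exact: integrable_density.
have ai : ig a.
  apply: integrable_Rsum => k.
  have := integrableMl mB (integrable_noether_current i j k Wu)
    (continuous_measurable_rV (D := B) (cdphi k)).
  apply; have [M _ MP] := continuous_bounded_B1 (cdphi k).
  by exists M; split => [|M' MM' x Bx]; [exact: num_real|rewrite /= (le_trans (MP _ Bx))// ltW].
have igZ (c : R) f : ig f -> ig (fun x => c * f x).
  by move=> fi; exact: (integrableZl mB c fi).
have igD f g : ig f -> ig g -> ig (fun x => f x + g x).
  by move=> fi gi; exact: (integrableD mB fi gi).
exists (2^-1 * \int[mu]_(x in B) e0 x), (2^-1 * \int[mu]_(x in B) b x) => t.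
rewrite (energyE nu (weak_gradient_variation t)).
have -> : \int[mu]_(x in B) density nu (fun l k x =>
      pseudorotation i j (C (t * phi x)) (D (t * phi x))
      (fun l => p k x l + t * partial k phi x * generator i j (y x) l) l) x =
    \int[mu]_(x in B) (e0 x + (- 2 * t) * a x + t ^+ 2 * b x).
  apply: eq_Rintegral => x _; have [_ _ _ _ CD1] := CD.
  rewrite /e0 /a /b /density !mulr_sumr -!big_split; apply: eq_bigr => k _ /=.
  rewrite sum_sgn_pseudorotation//.
  have -> : noether_current u i j x ord0 k =
      - \sum_l sgn l * (p k x l * generator i j (y x) l).
    by rewrite sum_sgn_generator// !mxE /y /p; ring.
  set S := \sum_l sgn l * (p k x l * _).
  rewrite (_ : - 2 * t * (- S * _) = S * (2 * t * partial k phi x)); last by ring.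
  rewrite /S mulr_suml mulr_sumr -!big_split.
  by apply: eq_bigr => l _ /=; ring.
rewrite (RintegralD mB (igD _ _ e0i (igZ _ _ ai)) (igZ _ _ bi)).
rewrite (RintegralD mB e0i (igZ _ _ ai)).
rewrite (RintegralZl _ mB ai) (RintegralZl _ mB bi) /distr_div -/(a _).
by field.
Qed.

Lemma variation_psphere t x : psphere nu (u x) -> psphere nu (variation t x).
Proof.
rewrite !psphereE => ux; under eq_bigr do rewrite mxE.
by have [_ _ _ _ CD1] := CD; rewrite sum_sgn_pseudorotation.
Qed.

Lemma variation_id t x : phi x = 0 -> variation t x = u x.
Proof.
have [C0 D0 _ _ _] := CD => phi0; apply/matrixP => l o; rewrite !ord1 mxE.
by rewrite phi0 mulr0 C0 D0 /pseudorotation subrr !mul0r !addr0.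
Qed.

Lemma variation0 x : variation 0 x = u x.
Proof.
have [C0 D0 _ _ _] := CD; apply/matrixP => l o; rewrite !ord1 mxE.
by rewrite mul0r C0 D0 /pseudorotation subrr !mul0r !addr0.
Qed.

Definition variation_velocity (x : 'rV[R]_m) : 'cV[R]_n.+1 :=
  \col_l (phi x * generator i j (y x) l).

Lemma vW12_variation_velocity : vW12 variation_velocity.
Proof.
move=> l; have := weak_gradientM sphi (weak_gradient_generator l).
move/weak_gradient_W12; congr W12.
by apply/funext => x; rewrite /component mxE.
Qed.

Lemma variation_quotient t x l :
  component (fun x => t^-1 *: (variation t x - variation 0 x) - variation_velocity x) l x
  = t^-1 * (C (t * phi x) - 1) * plane_part i j (y x) l
    + (t^-1 * D (t * phi x) - phi x) * generator i j (y x) l.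
Proof.
rewrite /component variation0 !mxE /pseudorotation -/(component u l x) -/(y x l); ring.
Qed.

(** The coefficients of this gradient are small with t: they are bounded in
    [variation_quotient_coefficients]. *)
Lemma weak_gradient_variation_quotient t l : t != 0 ->
  weak_gradient
    (component (fun x => t^-1 *: (variation t x - variation 0 x) - variation_velocity x) l)
    (fun k x => t^-1 * (C (t * phi x) - 1) * plane_part i j (p k x) l
      + (- (sgn i * sgn j) * D (t * phi x) * partial k phi x) * plane_part i j (y x) l
      + ((t^-1 * D (t * phi x) - phi x) * generator i j (p k x) l
      + (C (t * phi x) - 1) * partial k phi x * generator i j (y x) l)).
Proof.
move=> t0.
have sa : smooth (fun x => t^-1 * (C (t * phi x) + -1)).
  apply: smoothM; first exact: smooth_cst.
  by apply: smoothD; [exact: smooth_C|exact: smooth_cst].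
have sb : smooth (fun x => t^-1 * D (t * phi x) + -1 * phi x).
  apply: smoothD; apply: smoothM => //; [exact: smooth_cst|exact: smooth_D|].
  exact: smooth_cst.
have := weak_gradient_combination l sa sb; congr weak_gradient.
  by apply/funext => x; rewrite variation_quotient mulN1r.
apply/funext => k; apply/funext => x; rewrite mulN1r; congr (_ + _ + (_ + _)).
- rewrite partialZ; last first.
    by apply: smooth_derivable; apply: smoothD; [exact: smooth_C|exact: smooth_cst].
  rewrite partialD_cst; last exact: smooth_C.
  by rewrite partial_C; congr (_ * _); field.
- rewrite {1}/partial deriveD; [|apply: smooth_derivable..]; last 2 first.
  + by apply: smoothM; [exact: smooth_cst|exact: smooth_D].
  + by apply: smoothM; [exact: smooth_cst|].
  rewrite -!/(partial _ _ _) !partialZ; [|exact: smooth_derivable|exact/smooth_derivable/smooth_D].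
  by rewrite partial_D; congr (_ * _); field.
Qed.

End variation.

(** * Differentiability of the variation in the Sobolev norm *)

Section estimates.
Context {R : realType}.
Implicit Types a b c d e w z : R.

Lemma sqr_combination_le e a b w z : `|a| <= e -> `|b| <= e ->
  (a * w + b * z) ^+ 2 <= e ^+ 2 * (2 * (w ^+ 2 + z ^+ 2)).
Proof.
move=> ae be.
have sq f : `|f| <= e -> f ^+ 2 <= e ^+ 2.
  move=> fe; rewrite -(real_normK (num_real f)) ler_pXn2r ?nnegrE//.
  exact: le_trans fe.
apply: (@le_trans _ _ (2 * (a ^+ 2 * w ^+ 2 + b ^+ 2 * z ^+ 2))).
  by have := sqr_ge0 (a * w - b * z); nra.
rewrite [leRHS]mulrCA ler_pM2l// mulrDr lerD// ler_wpM2r ?sqr_ge0//; exact: sq.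
Qed.

Lemma sqr_combination4_le e a b c d w z w' z' :
  `|a| <= e -> `|b| <= e -> `|c| <= e -> `|d| <= e ->
  (a * w + b * z + (c * w' + d * z')) ^+ 2 <=
    e ^+ 2 * (4 * (w ^+ 2 + z ^+ 2 + (w' ^+ 2 + z' ^+ 2))).
Proof.
move=> ae be ce de.
have h1 := sqr_combination_le w z ae be; have h2 := sqr_combination_le w' z' ce de.
move: h1 h2; set X := a * w + b * z; set Y := c * w' + d * z' => h1 h2.
have := sqr_ge0 (X - Y); nra.
Qed.

End estimates.

Section variation_differentiable.
Context {R : realType} (m n nu : nat).
Local Notation mu := (lebesgue_rV m : {measure set 'rV[R]_m -> \bar R}).
Local Notation B := (B1 m : set 'rV[R]_m).
Local Notation ig f := (mu.-integrable B (EFin \o f)).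
Local Notation sgn := (@sgn R n nu).
Local Notation generator := (@generator R n nu).
Context (u : 'rV[R]_m -> 'cV[R]_n.+1) (i j : 'I_n.+1) (phi : 'rV[R]_m -> R).
Context (C D : R -> R).
Hypotheses (Wu : vW12 u) (ij : i != j) (sphi : smooth phi).
Hypothesis CD : rotation_pair (sgn i * sgn j) C D.
Implicit Types (l : 'I_n.+1) (k : 'I_m) (t : R).

Let y (x : 'rV[R]_m) l : R := component u l x.
Let p k (x : 'rV[R]_m) l : R := wpartial k (component u l) x.

Lemma C1_bounded_B1 : exists2 M : R, 0 <= M & forall x, B x ->
  `|phi x| <= M /\ forall k, `|partial k phi x| <= M.
Proof.
have [M0 M00 M0P] := continuous_bounded_B1 (smooth_continuous sphi).
have /choice[Mk MkP] : forall k, exists M : R, 0 <= M /\ forall x, B x -> `|partial k phi x| <= M.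
  move=> k; have [M M0' MP] := continuous_bounded_B1
    (smooth_continuous (smooth_partial k sphi)).
  by exists M.
have S0 : 0 <= \sum_k Mk k by apply: sumr_ge0 => k _; case: (MkP k).
exists (M0 + \sum_k Mk k); first exact: addr_ge0.
move=> x Bx; split; first by rewrite (le_trans (M0P _ Bx))// lerDl.
move=> k; apply: le_trans ((MkP k).2 _ Bx) _.
rewrite (bigD1 k)//= addrCA lerDl addr_ge0//.
by apply: sumr_ge0 => k' _; case: (MkP k').
Qed.

(** Values of phi and its first derivatives on the ball are bounded by M1, and |t| <= 1/M1 keeps the
    angle t phi in [-1, 1], where the estimates of the rotation pair hold. *)
Lemma variation_quotient_coefficients : exists2 e : R, 0 < e & exists2 L : R, 0 <= L &
  forall t, t != 0 -> `|t| <= e -> forall x, B x ->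
  [/\ `|t^-1 * (C (t * phi x) - 1)| <= L * `|t|,
      `|t^-1 * D (t * phi x) - phi x| <= L * `|t|
    & forall k,
      `|- (sgn i * sgn j) * D (t * phi x) * partial k phi x| <= L * `|t| /\
      `|(C (t * phi x) - 1) * partial k phi x| <= L * `|t| ].
Proof.
have s1 : `|sgn i * sgn j| = 1.
  by rewrite /sgn; do 2 case: ifP => _; rewrite ?mulrNN ?mulN1r ?mul1r ?normrN normr1.
have [K K0 KP] : exists2 K, 0 <= K & forall x, `|x| <= 1 ->
    [/\ `|C x - 1| <= K * `|x| ^+ 2, `|D x| <= K * `|x|
      & `|D x - x| <= K * `|x| ^+ 2].
  by apply: (rotation_pair_estimates CD); rewrite s1.
have [M M0 MP] := C1_bounded_B1; pose M1 := M + 1.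
have M10 : 0 < M1 by rewrite ltr_wpDl.
exists M1^-1; first by rewrite invr_gt0.
exists (K * M1 ^+ 2); first by rewrite mulr_ge0// exprn_ge0// ltW.
move=> t t0 te x Bx; have [phiM dphiM] := MP _ Bx.
have {}phiM : `|phi x| <= M1 by rewrite (le_trans phiM)// lerDl.
have {}dphiM k : `|partial k phi x| <= M1 by rewrite (le_trans (dphiM k))// lerDl.
have tM : `|t| * M1 <= 1 by rewrite -ler_pdivlMr// div1r.
have tphiM : `|t * phi x| <= `|t| * M1 by rewrite normrM ler_wpM2l.
have [Ce De De'] := KP _ (le_trans tphiM tM).
have t_gt0 : 0 < `|t| by rewrite normr_gt0.
have quad : K * `|t * phi x| ^+ 2 <= `|t| * (K * M1 ^+ 2 * `|t|).
  have -> : `|t| * (K * M1 ^+ 2 * `|t|) = K * (`|t| * M1) ^+ 2 by ring.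
  by rewrite ler_wpM2l// ler_pXn2r ?nnegrE// mulr_ge0// ltW.
have lin : K * (`|t| * M1) * M1 <= K * M1 ^+ 2 * `|t|.
  by rewrite le_eqVlt; apply/orP; left; apply/eqP; ring.
split=> [||k]; last split.
- rewrite normrM normfV ler_pdivrMl//; exact: le_trans Ce quad.
- have -> : t^-1 * D (t * phi x) - phi x = t^-1 * (D (t * phi x) - t * phi x).
    by field.
  rewrite normrM normfV ler_pdivrMl//; exact: le_trans De' quad.
- rewrite normrM normrM normrN s1 mul1r; apply: le_trans lin.
  apply: ler_pM => //; apply: (le_trans De); exact: ler_wpM2l.
- rewrite normrM; apply: le_trans lin.
  apply: ler_pM => //; apply: (le_trans Ce); apply: ler_wpM2l => //.
  rewrite expr2 (le_trans _ tphiM)// ler_piMl//; exact: le_trans tphiM tM.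
Qed.

Let quotient t (x : 'rV[R]_m) : 'cV[R]_n.+1 :=
  t^-1 *: (variation nu u i j phi C D t x - variation nu u i j phi C D 0 x)
  - variation_velocity nu u i j phi x.

(** Pointwise, the remainder and its gradient are combinations of fixed
    square-integrable functions with coefficients bounded by L |t|. *)
Lemma variation_quotient_norm : exists2 e : R, 0 < e & exists2 c : R, 0 <= c &
  forall t, t != 0 -> `|t| <= e -> vW12_norm (quotient t) <= c * `|t|.
Proof.
have [e e0 [L L0 coef]] := variation_quotient_coefficients.
have mB := @measurable_B1 R m.
have igD f g : ig f -> ig g -> ig (fun x => f x + g x).
  by move=> fi gi; exact: (integrableD mB fi gi).
have igZ (c : R) f : ig f -> ig (fun x => c * f x).
  by move=> fi; exact: (integrableZl mB c fi).
have W2 l : L2 (fun x => plane_part i j (y x) l) by case: (weak_gradient_plane_part i j Wu l).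
have Z2 l : L2 (fun x => generator i j (y x) l).
  by case: (weak_gradient_generator nu i j Wu l).
have WG2 l k : L2 (fun x => plane_part i j (p k x) l).
  by case: (weak_gradient_plane_part i j Wu l) => _ /(_ k)[].
have ZG2 l k : L2 (fun x => generator i j (p k x) l).
  by case: (weak_gradient_generator nu i j Wu l) => _ /(_ k)[].
pose f0 l x : R := 2 * (plane_part i j (y x) l ^+ 2 + generator i j (y x) l ^+ 2).
pose f1 l k x : R := 4 * (plane_part i j (p k x) l ^+ 2 + plane_part i j (y x) l ^+ 2
  + (generator i j (p k x) l ^+ 2 + generator i j (y x) l ^+ 2)).
have f0i l : ig (f0 l).
  exact: (igZ _ _ (igD _ _ (W2 l).2 (Z2 l).2)).
have f1i l k : ig (f1 l k).
  exact: (igZ _ _ (igD _ _ (igD _ _ (WG2 l k).2 (W2 l).2)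
    (igD _ _ (ZG2 l k).2 (Z2 l).2))).
pose S := \sum_l (\int[mu]_(x in B) f0 l x + \sum_k \int[mu]_(x in B) f1 l k x).
have f00 l x : 0 <= f0 l x by rewrite mulr_ge0// addr_ge0// sqr_ge0.
have f10 l k x : 0 <= f1 l k x.
  by rewrite mulr_ge0// addr_ge0// addr_ge0// sqr_ge0.
have S0 : 0 <= S.
  apply: sumr_ge0 => l _; apply: addr_ge0; first exact: Rintegral_ge0.
  by apply: sumr_ge0 => k _; exact: Rintegral_ge0.
exists e => //; exists (L * Num.sqrt S); first by rewrite mulr_ge0// sqrtr_ge0.
move=> t t0 te.
have WQ l := weak_gradient_variation_quotient Wu sphi CD l t0.
have LQ l : L2 (component (quotient t) l) by case: (WQ l).
have vWQ : vW12 (quotient t) by move=> l; exact: weak_gradient_W12 (WQ l).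
have -> : L * Num.sqrt S * `|t| = Num.sqrt ((L * `|t|) ^+ 2 * S).
  rewrite sqrtrM ?sqr_ge0// sqrtr_sqr (@ger0_norm _ (L * _)) ?mulr_ge0//; ring.
rewrite /vW12_norm ler_wsqrtr// /S mulr_sumr; apply: ler_sum => l _.
rewrite mulrDr mulr_sumr; apply: lerD; [|apply: ler_sum => k _].
  rewrite -RintegralZl//; apply: le_Rintegral => //.
  - exact: (LQ l).2.
  - exact: igZ.
  move=> x Bx; rewrite -/(component (quotient t) l x).
  have -> := @variation_quotient R m n nu u i j phi C D CD t x l.
  by have [c1 c2 _] := coef t t0 te x Bx; exact: sqr_combination_le.
have [_ /(_ k)[G2 wG]] := WQ l.
have mJ : measurable_fun B (fun x => jac (quotient t) x l k ^+ 2).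
  by apply: measurable_funX; case: (L2_jac l k vWQ).
have JG := jac_ae WQ.
rewrite (Rintegral_ae_eq mJ (measurable_funX 2 G2.1)); last first.
  by apply: filterS JG => x h Bx; rewrite h.
rewrite -RintegralZl//; apply: le_Rintegral => //; [exact: G2.2|exact: igZ|].
move=> x Bx; have [c1 c2 /(_ k)[c3 c4]] := coef t t0 te x Bx.
exact: sqr_combination4_le.
Qed.

Lemma variation_differentiable : W12_differentiable0 (variation nu u i j phi C D).
Proof.
exists (variation_velocity nu u i j phi).
  exact: vW12_variation_velocity.
have [e e0 [c c0 bnd]] := variation_quotient_norm.
apply: (@squeeze_cvgr _ _ _ _ (fun=> 0) (fun t => c * `|t|)).
- near=> t; rewrite sqrtr_ge0/=; apply: bnd.
    by near: t; exact: nbhs_dnbhs_neq.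
  by near: t; exact: dnbhs0_le.
- exact: cvg_cst.
- rewrite -[X in _ --> X](mulr0 c); apply: cvgM; first exact: cvg_cst.
  have : (fun t : R => t) @ 0^' --> (0 : R) by exact: cvg_within.
  by move/cvg_norm; rewrite normr0; exact.
Unshelve. all: by end_near. Qed.

End variation_differentiable.

Theorem proposition1p1 (R : realType) (m n nu : nat) (hm : (2 <= m)%N)
    (hnu : (1 <= nu)%N) (hnun : (nu <= n)%N)
    (u : 'rV[R]_m -> 'cV[R]_n.+1) (hu : weakly_harmonic nu u) :
  forall i j : 'I_n.+1,
    div_free (fun x => component u i x *: wgrad (component u j) x
                       - component u j x *: wgrad (component u i) x).
Proof.
have [[Wu Su] crit] := hu.
move=> i j.
have mB := @measurable_B1 R m.
split.
  move=> k K cK KB; have mK := compact_measurable_rV cK.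
  exact: integrableS mB mK KB (integrable_noether_current i j k Wu).
move=> phi tphi.
have [<-|ij] := eqVneq i j.
  rewrite /distr_div; under eq_Rintegral do
    (under eq_bigr do rewrite subrr mxE mul0r; rewrite big1//).
  by rewrite Rintegral_cst ?mul0r ?oppr0.
have sphi := test_function_smooth tphi.
have s1 : @sgn R n nu i * sgn nu j = 1 \/ @sgn R n nu i * sgn nu j = -1.
  by rewrite /sgn; do 2 case: ifP => _; rewrite ?mulrNN ?mulr1 ?mul1r; tauto.
have [C [D CD]] := rotation_pair_exists s1.
have adm : admissible nu u (variation nu u i j phi C D).
  split.
  - near=> t; split.
      by move=> l; exact: weak_gradient_W12 (weak_gradient_variation Wu ij sphi CD t l).
    by apply: filterS Su => x h Bx; apply: variation_psphere => //; exact: h.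
  - by apply: aeW => x _; exact: (variation0 u phi CD).
  - case: tphi => _ cphi Bphi; exists (supp phi); split => //.
    near=> t; apply: aeW => x _ Kx; apply: (variation_id u CD).
    by apply: contrapT => /eqP phi0; apply: Kx; exact: subset_closure.
  - exact: variation_differentiable.
have [a [c E]] := energy_variation Wu ij sphi CD.
set d := distr_div _ _ in E *.
have [_ crit0] := crit _ adm.
have dE : is_derive (0 : R) 1 (fun t : R => a + t * d + t ^+ 2 * c) d.
  have tt : is_derive (0 : R) 1 (fun t : R => t ^+ 2) 0.
    have := is_deriveX 2 (is_derive_id (0 : R) 1).
    by move=> H; apply: (is_derive_eq H); rewrite /= mulr0 scale0r.
  have H := is_deriveD (is_deriveD (is_derive_cst a (0 : R) 1)
    (is_deriveM (is_derive_id (0 : R) 1) (is_derive_cst d (0 : R) 1)))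
    (is_deriveM tt (is_derive_cst c (0 : R) 1)).
  by apply: (is_derive_eq H); rewrite /GRing.scale/=; ring.
rewrite -crit0 -(@derive_val _ _ _ _ _ _ _ dE); congr (derive _ _ _).
by apply/funext => t /=; rewrite E.
Unshelve. all: by end_near. Qed.
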